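(* Let $r\ge2$ be an integer and let $\mathcal{C}^r$ be the set of partitions $\mu$ with nonnegative $r$-th differences, i.e. $\triangle_i^r(\mu)\ge0$ for all $i\ge1$. Then the conjugate limit shape of $\mathcal{C}^r$ under the scaling function $\beta(n)=n^{1/(1+r)}$ is \[ t\mapsto\int_t^\infty\frac{(y-t)^{r-1}}{(r-1)!}\,\frac{e^{-cy^r/r!}}{1-e^{-cy^r/r!}}\,dy,\qquad t>0,\qquad\text{where } c=d(r,1/r!). \]
   Context: For a partition $\lambda=(\lambda_1\ge\dots\ge\lambda_\ell>0)$, $\triangle_i^k(\lambda)=\lambda_i$ if $i=\ell$ or $k=0$, and $\triangle_i^k(\lambda)=\triangle_i^{k-1}(\lambda)-\triangle_{i+1}^{k-1}(\lambda)$ otherwise. Conjugate diagram function: $\rho_\lambda(x)=\lambda_{\lceil x\rceil}$ for $0<x\le\ell$, $0$ for $x>\ell$; scaled version $\widehat\rho_\lambda(x)=\frac{\beta(n)}n\rho_\lambda(\beta(n)x)$ for $|\lambda|=n$. With $\mathbb{P}_n$ uniform on elements of size $n$ of a set $\mathcal{A}$, a function $G$ is the conjugate limit shape of $\mathcal{A}$ under $\beta$ if for all finitely many continuity points $t_1,\dots,t_k$ and $\epsilon>0$, $\mathbb{P}_n(|\widehat\rho_\lambda(t_j)-G(t_j)|<\epsilon\ \forall j)\to1$ as $n\to\infty$. $d(r,B)=\big[\zeta(1+\frac1r)\Gamma(1+\frac1r)/(rB^{1/r})\big]^{r/(1+r)}$. *)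

(* Defs.v *)
From HB Require Import structures.
From mathcomp Require Import all_boot all_order all_algebra.
From mathcomp Require Import finmap.
From mathcomp Require Import all_classical all_reals all_analysis.

Set Implicit Arguments.
Unset Strict Implicit.
Unset Printing Implicit Defensive.
Import Order.TTheory GRing.Theory Num.Theory.
Import numFieldNormedType.Exports.
Local Open Scope classical_set_scope.
Local Open Scope ring_scope.

Record intpart := IntPart {
  parts :> seq nat;
  _ : sorted geq parts && (0%N \notin parts) }.

HB.instance Definition _ := [isSub for parts].
HB.instance Definition _ := [Choice of intpart by <:].

(* The number of parts ell is [size l]; the sum |lambda| of the parts is
   [weight l]. *)
Definition weight (l : intpart) : nat := sumn l.

(* lambda_i with the 1-based indexing of the literature; 0 for i > ell. *)
Definition part (l : intpart) (i : nat) : nat := nth 0%N l i.-1.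

(* Integer valued, so that subtraction is not truncated. For i > ell the
   recursion returns 0. *)
Fixpoint triangle (k i : nat) (l : intpart) : int :=
  match k with
  | 0 => (part l i)%:Z
  | k'.+1 => if i == size l then (part l i)%:Z
             else triangle k' i l - triangle k' i.+1 l
  end.

Definition nonneg_differences (r : nat) : set intpart :=
  [set l | forall i, (1 <= i)%N -> 0 <= triangle r i l].

Definition conj_diagram (R : realType) (l : intpart) (x : R) : R :=
  if (0 < x) && (x <= (size l)%:R) then (part l `|Num.ceil x|%N)%:R else 0.

Definition scaled_conj_diagram (R : realType) (beta : nat -> R)
    (l : intpart) (x : R) : R :=
  let n := weight l in beta n / n%:R * conj_diagram l (beta n * x).

Definition of_weight (n : nat) : set intpart := [set l | weight l = n].

(* [fset_set] is meaningful on finite sets only. *)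
Lemma finite_of_weight (n : nat) : finite_set (of_weight n).
Proof.
have e0 : sorted geq [::] && (0%N \notin [::]) by [].
pose g (b : n.-bseq 'I_n.+1) : intpart :=
  insubd (IntPart e0) [seq val i | i <- b].
apply: (@sub_finite_set _ _ (g @` setT)); last exact/finite_image/finite_finset.
move=> l /= wl.
have le_sumn (s : seq nat) x : x \in s -> (x <= sumn s)%N.
  elim: s => // y s IH; rewrite inE /= => /orP[/eqP->|/IH]; first exact: leq_addr.
  by move/leq_trans; apply; apply: leq_addl.
have size_sumn (s : seq nat) : 0%N \notin s -> (size s <= sumn s)%N.
  elim: s => // y s IH; rewrite inE negb_or /= => /andP[y0 /IH].
  by rewrite -add1n; apply: leq_add; rewrite lt0n eq_sym.
have /andP[_ l0] := valP l.
have sz : (size [seq inord i : 'I_n.+1 | i <- (l : seq nat)] <= n)%N.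
  by rewrite size_map -wl size_sumn.
exists (Bseq sz) => //; apply: val_inj; rewrite /g /=.
have -> : [seq nat_of_ord i | i <- [seq inord i : 'I_n.+1 | i <- (l : seq nat)]]
    = parts l.
  rewrite -map_comp -[RHS]map_id; apply/eq_in_map => x /le_sumn xl /=.
  by rewrite inordK // ltnS -wl.
by rewrite insubdK //; exact: (valP l).
Qed.

(* P_n(E) for the uniform distribution P_n on the elements of weight n of A. *)
Definition unif_prob (R : realType) (A : set intpart) (n : nat)
    (E : set intpart) : R :=
  #|` fset_set (A `&` of_weight n `&` E)|%:R
    / #|` fset_set (A `&` of_weight n)|%:R.

(* The shape is a function on (0, +oo); values of G outside it are not used. *)
Definition conjugate_limit_shape (R : realType) (A : set intpart)
    (beta : nat -> R) (G : R -> R) : Prop :=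
  forall (k : nat) (t : 'I_k -> R) (eps : R),
    (forall j, 0 < t j /\ {for t j, continuous G}) -> 0 < eps ->
    unif_prob R A n
      [set l | forall j, `|scaled_conj_diagram beta l (t j) - G (t j)| < eps]
    @[n --> \oo] --> (1 : R).

Definition zeta (R : realType) (s : R) : R :=
  limn (series (fun k => k.+1%:R `^ (- s))).

Definition Gamma (R : realType) (x : R) : R :=
  \int[lebesgue_measure]_(u in `]0, +oo[) (u `^ (x - 1) * expR (- u)).

Definition dconst (R : realType) (r B : R) : R :=
  (zeta (1 + r^-1) * Gamma (1 + r^-1) / (r * B `^ r^-1)) `^ (r / (1 + r)).

(* Main.v *)
Require Import Defs.
From HB Require Import structures.
From mathcomp Require Import all_boot all_order all_algebra.
From mathcomp Require Import finmap.
From mathcomp Require Import all_classical all_reals all_analysis.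
From mathcomp Require Import measurable_realfun zify ring lra.
Import Order.TTheory GRing.Theory Num.Theory.
Import numFieldNormedType.Exports.
Local Open Scope classical_set_scope.
Local Open Scope ring_scope.

(**
Taking r-th differences maps the partitions of n in the set bijectively onto
the finitely supported multiplicities m_k (k >= 0) with sum_k m_k C(k+r, r) = n,
and part j+1 is the linear functional sum_(k >= j) C(k-j+r-1, r-1) m_k.  Give m the
Boltzmann weight e^(-s n) with s = c n^(-r/(1+r)): the m_k become independent
geometric variables with mean 1 / (e^(s C(k+r, r)) - 1), and c is the value for
which the mean energy is asymptotic to n.  Tilting the weights (Chernoff) bounds
the number of partitions of n violating the limit shape by
e^(entropy - const n^(1/(1+r))).  The total number of partitions of n is at least
e^(entropy - o(n^(1/(1+r)))), because the energy of the slightly cooled Boltzmann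
measure is concentrated just below n and a deficit in the energy can be stored in
m_0, whose weight is 1.  The means are Riemann sums, whose limits come from
dominated convergence.
*)

(** All estimates are compared on the exponential scale [scale n] = n^(1/(1+r)), where
    [temp n * n = c * scale n]. The upper and the lower bound share the same main term, so no local
    limit theorem is needed: only errors of order [scale n] matter, and the factor n + 1 lost by
    storing the deficit is negligible. A tilt of relative size kap changes the log partition
    function by a linear term, which is the Boltzmann mean, plus a remainder of at most a constant
    times kap^2 [scale n]. A deviation eps of a part gains linearly in kap, so a small fixed kap
    wins. The remainder is uniform because the tilt of mode k is at most kap times its own energy;
    for the part at abscissa t > 0 this holds since only modes k of order at least t [scale n]
    contribute to it. Cooling is needed because at [temp n] the mean energy is merely asymptotic to
    n, while mass above n cannot be completed to a partition of n. Multiplicities stay in finite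
    boxes, so finite sums replace probability spaces. *)

Set Implicit Arguments.
Unset Strict Implicit.
Unset Printing Implicit Defensive.

(** * Iterated tail sums *)

(* [diffbin r d] is the number of ways to write [d] as a sum of [r] ordered
   naturals, i.e. the kernel of the [r]-fold tail sum; the case [r = 0] is the
   Kronecker delta because of the truncated predecessor. *)
Definition diffbin (r d : nat) : nat := 'C((d + r).-1, d).

Lemma diffbin0n d : diffbin 0 d = (d == 0)%N.
Proof. by case: d => [|d]; rewrite /diffbin ?addn0 //= bin_small. Qed.

Lemma diffbinn0 r : diffbin r 0 = 1%N.
Proof. by rewrite /diffbin bin0. Qed.

Lemma diffbinSS r d :
  diffbin r.+1 d.+1 = (diffbin r d.+1 + diffbin r.+1 d)%N.
Proof. by rewrite /diffbin addSn !addnS /= binS. Qed.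

(** [N] stands for any bound on the support of the multiplicities; it keeps the tail sums finite. *)
Definition tailsum (r N : nat) (m : nat -> nat) (i : nat) : nat :=
  \sum_(k < N | (i <= k)%N) diffbin r (k - i) * m k.

Lemma tailsum0 N m i : (i < N)%N -> tailsum 0 N m i = m i.
Proof.
move=> iN; rewrite /tailsum (bigD1 (Ordinal iN)) //= subnn diffbinn0 mul1n.
rewrite big1 ?addn0 // => k /andP[ik kN]; rewrite diffbin0n subn_eq0.
by move: kN; rewrite -val_eqE /= eqn_leq ik andbT => /negPf->.
Qed.

Lemma tailsum_oversize r N m i : (N <= i)%N -> tailsum r N m i = 0%N.
Proof.
by move=> Ni; rewrite /tailsum big1 // => k /(leq_trans Ni); rewrite leqNgt ltn_ord.
Qed.

(** Pascal's rule for the kernel: one difference lowers the order of a tail sum by one, so tail sums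
    invert differences. *)
Lemma tailsumS r N m i :
  tailsum r.+1 N m i = (tailsum r N m i + tailsum r.+1 N m i.+1)%N.
Proof.
case: (ltnP i N) => iN; last by rewrite !tailsum_oversize // leqW.
rewrite /tailsum (bigD1 (Ordinal iN)) //= [in RHS](bigD1 (Ordinal iN)) //=.
rewrite !subnn !diffbinn0 -!addnA; congr addn.
have e : forall k : 'I_N, ((i <= k)%N && (k != Ordinal iN)) = (i < k)%N.
  by move=> k; rewrite ltn_neqAle -val_eqE /= andbC eq_sym.
rewrite !(eq_bigl _ _ e) -big_split /=; apply: eq_bigr => k ik.
by rewrite -(subnSK ik) diffbinSS mulnDl.
Qed.

Lemma tailsum_nonincr r N m i : (tailsum r.+1 N m i.+1 <= tailsum r.+1 N m i)%N.
Proof. by rewrite [leqRHS]tailsumS leq_addl. Qed.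

(** Telescoping [tailsumS]; this turns the size of a partition into the energy of its
    multiplicities. *)
Lemma sum_tailsum r N m :
  (\sum_(i < N) tailsum r N m i = \sum_(k < N) diffbin r.+1 k * m k)%N.
Proof.
have -> : (\sum_(k < N) diffbin r.+1 k * m k)%N = tailsum r.+1 N m 0.
  by apply: eq_bigr => k _; rewrite subn0.
have H n : (n <= N)%N ->
    (\sum_(i < n) tailsum r N m i + tailsum r.+1 N m n = tailsum r.+1 N m 0)%N.
  elim: n => [|n IH] nN; first by rewrite big_ord0.
  by rewrite big_ord_recr /= -addnA -tailsumS IH // ltnW.
by rewrite -(H N) // (@tailsum_oversize _ _ _ N) ?addn0.
Qed.

(** * Partitions and their differences *)

Lemma part_oversize (l : intpart) i : (size l <= i)%N -> part l i.+1 = 0%N.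
Proof. by move=> h; rewrite /part nth_default. Qed.

Lemma triangle_oversize k (l : intpart) i :
  (size l <= i)%N -> triangle k i.+1 l = 0.
Proof.
elim: k i => [|k IH] i h /=; first by rewrite part_oversize.
rewrite gtn_eqF; last by rewrite ltnS.
by rewrite !IH ?subrr // leqW.
Qed.

(** The special clause at the last part agrees with the plain recursion, because everything beyond
    the last part vanishes. From here on no boundary case is left. *)
Lemma triangleS k (l : intpart) i :
  triangle k.+1 i.+1 l = triangle k i.+1 l - triangle k i.+2 l.
Proof.
rewrite /=; case: eqP => // e.
rewrite (@triangle_oversize k l i.+1) ?e // subr0.
by case: k => //= k; rewrite eqxx.
Qed.

Lemma size_le_weight (l : intpart) : (size l <= weight l)%N.
Proof.
have /andP[_ l0] := valP l; rewrite /weight; move: l0 => /=.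
elim: (parts l) => // y s IH; rewrite inE negb_or /= => /andP[y0 /IH].
by rewrite -add1n; apply: leq_add; rewrite lt0n eq_sym.
Qed.

Lemma weight_sum_part N (l : intpart) : (size l <= N)%N ->
  weight l = (\sum_(i < N) part l i.+1)%N.
Proof.
move=> h; rewrite /weight sumnE (big_nth 0%N) big_mkord.
transitivity (\sum_(i < size l) part l i.+1)%N; first exact: eq_bigr.
rewrite (big_ord_widen N (fun i => part l i.+1)) // big_mkcond /=.
by apply: eq_bigr => i _; case: ltnP => // /part_oversize.
Qed.

Lemma intpart_of_nonincr N (u : nat -> nat) :
  (forall i, u i.+1 <= u i)%N -> u N = 0%N ->
  exists2 l : intpart, (size l <= N)%N & forall i, part l i.+1 = u i.
Proof.
move=> um uN.
have mono i j : (i <= j)%N -> (u j <= u i)%N.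
  elim: j => [|j IH]; first by rewrite leqn0 => /eqP->.
  rewrite leq_eqVlt => /predU1P[->//|]; rewrite ltnS => /IH.
  exact: leq_trans (um j).
(* Cutting at the first zero keeps exactly the positive values, as [intpart] demands; by
   monotonicity all later values are zero. *)
have ex : exists i, u i == 0%N by exists N; rewrite uN.
case: (ex_minnP ex) => M /eqP uM minM.
have P : sorted geq (mkseq u M) && (0%N \notin mkseq u M).
  apply/andP; split.
    by apply: homo_sorted (iota_ltn_sorted 0 M) => i j /ltnW /mono.
  apply/mapP => -[i]; rewrite mem_iota /= => iM e.
  by have := minM i; rewrite -e eqxx => /(_ isT); rewrite leqNgt iM.
exists (IntPart P) => [|i]; first by rewrite size_mkseq minM // uN.
rewrite /part /=; case: (ltnP i M) => iM; first by rewrite nth_mkseq.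
rewrite nth_default ?size_mkseq //; apply/eqP; rewrite eq_sym -leqn0 -uM.
exact: mono.
Qed.

Lemma eq_of_differences (N : nat) (f g : nat -> int) :
  (forall i, (N <= i)%N -> f i = g i) ->
  (forall i, f i - f i.+1 = g i - g i.+1) -> f =1 g.
Proof.
move=> fN fg i; case: (leqP N i) => [/fN//|]; move: i.
have H d i : (N - i = d)%N -> f i = g i.
  elim: d i => [|d IH] i e; first by apply: fN; rewrite -subn_eq0 e.
  have e1 : f i.+1 = g i.+1 by apply: IH; rewrite subnS e.
  by have := fg i; rewrite e1 => /addIr.
by move=> i _; exact: (H (N - i)%N).
Qed.

(** Each tail sum undoes one difference: [j] of them lead from the r-th differences back to order
    [r - j]. Vanishing beyond [N] fixes the constant of summation at every stage. *)
Lemma triangle_tailsum (r N : nat) (l : intpart) (m : nat -> nat) :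
  (size l <= N)%N -> (forall k, (k < N)%N -> triangle r k.+1 l = (m k)%:Z) ->
  forall i, part l i.+1 = tailsum r N m i.
Proof.
move=> sN mE.
have H j : (j <= r)%N -> forall i, triangle (r - j) i.+1 l = (tailsum j N m i)%:Z.
  elim: j => [_|j IH jr].
    move=> i; rewrite subn0; case: (ltnP i N) => iN.
      by rewrite tailsum0 // mE.
    by rewrite tailsum_oversize // triangle_oversize // (leq_trans sN).
  apply: (@eq_of_differences N) => i.
    by move=> Ni; rewrite tailsum_oversize // triangle_oversize // (leq_trans sN).
  rewrite -triangleS subnSK // IH 1?ltnW // (tailsumS j N m i) PoszD; lia.
by move=> i; apply/eqP; rewrite -eqz_nat -(H r) // subnn.
Qed.

Lemma tailsum_triangle (r N : nat) (l : intpart) (m : nat -> nat) :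
  (forall i, part l i.+1 = tailsum r N m i) ->
  forall k, (k < N)%N -> triangle r k.+1 l = (m k)%:Z.
Proof.
move=> lE.
have H j : (j <= r)%N -> forall i, triangle j i.+1 l = (tailsum (r - j) N m i)%:Z.
  elim: j => [_ i|j IH jr i]; first by rewrite subn0 /= lE.
  rewrite triangleS !IH 1?ltnW // -(subnSK jr) (tailsumS _ N m i) PoszD; lia.
by move=> k kN; rewrite H // subnn tailsum0.
Qed.

(** The absolute value only moves the difference into [nat]; it changes nothing on
    [nonneg_differences r]. *)
Definition mult (r : nat) (l : intpart) (k : nat) : nat := `|triangle r k.+1 l|%N.

Lemma multE r l k : nonneg_differences r l -> triangle r k.+1 l = (mult r l k)%:Z.
Proof. by move=> /(_ k.+1 isT) h; rewrite /mult gez0_abs. Qed.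

Lemma part_mult r N l i : nonneg_differences r l -> (size l <= N)%N ->
  part l i.+1 = tailsum r N (mult r l) i.
Proof. by move=> lA sN; apply: triangle_tailsum => // k _; exact: multE. Qed.

Lemma weight_mult r N l : nonneg_differences r l -> (size l <= N)%N ->
  weight l = (\sum_(k < N) diffbin r.+1 k * mult r l k)%N.
Proof.
move=> lA sN; rewrite (weight_sum_part sN) -sum_tailsum.
by apply: eq_bigr => i _; exact: part_mult.
Qed.

Lemma mult_inj r N l l' : nonneg_differences r l -> nonneg_differences r l' ->
  (size l <= N)%N -> (size l' <= N)%N ->
  (forall k, (k < N)%N -> mult r l k = mult r l' k) -> l = l'.
Proof.
move=> lA lA' sN sN' e.
have pE i : part l i.+1 = part l' i.+1.
  rewrite (part_mult i lA sN) (part_mult i lA' sN').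
  by apply: eq_bigr => k _; rewrite e.
(* Parts are padded with zeros, and no entry of a partition is zero, so equal parts force equal
   lengths. *)
have szP (l1 l2 : intpart) : (forall i, part l1 i.+1 = part l2 i.+1) ->
    (size l1 <= size l2)%N.
  move=> E; rewrite leqNgt; apply/negP => lt.
  have := E (size l2); rewrite [RHS]part_oversize // => e0.
  have /andP[_ /negP l10] := valP l1; have := mem_nth 0%N lt.
  by rewrite -/(part l1 (size l2).+1) e0 => /l10.
apply: val_inj; apply: (@eq_from_nth _ 0%N) => [|i _]; last exact: (pE i).
by apply/eqP; rewrite eqn_leq !szP.
Qed.

(** Surjectivity of the difference map: at least one summation makes arbitrary multiplicities
    nonincreasing. *)
Lemma exists_intpart_mult (r N : nat) (m : nat -> nat) : (0 < r)%N ->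
  exists l : intpart, [/\ nonneg_differences r l,
    weight l = (\sum_(k < N) diffbin r.+1 k * m k)%N &
    forall k, (k < N)%N -> mult r l k = m k].
Proof.
case: r => // r _.
have [l sN lE] := @intpart_of_nonincr N (tailsum r.+1 N m)
  (tailsum_nonincr r N m) (tailsum_oversize r.+1 m (leqnn N)).
have tE := tailsum_triangle lE.
exists l; split => [i|//|k kN]; last by rewrite /mult tE.
- case: i => // i _; case: (ltnP i N) => iN; first by rewrite tE.
  by rewrite triangle_oversize // (leq_trans sN).
- rewrite (weight_sum_part sN) -sum_tailsum.
  by apply: eq_bigr => i _.
Qed.

(** * The Bose-Einstein function [1 / (e^x - 1)] *)

Section bose.
Context {R : realType}.
Implicit Types (x y d kap : R).

Definition bose x : R := (expR x - 1)^-1.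

(** Log partition function of one mode, i.e. the logarithm of the geometric series in [expR (- x)].
    Its derivative is [- bose x], which makes [bose x] the mean multiplicity. *)
Definition logpart x : R := - ln (1 - expR (- x)).

(** A partial sum of the exponential series. The cubic term is what yields
    [expR x - 1 >= x (1 + x)^2 / 6], the source of the decay of [bose] at infinity. *)
Lemma expR_ge_cubic x : 0 <= x -> 1 + x + x ^+ 2 / 2 + x ^+ 3 / 6 <= expR x.
Proof.
move=> x0; have -> : 1 + x + x ^+ 2 / 2 + x ^+ 3 / 6 = series (exp_coeff x) 4%N.
  rewrite /series /= /exp_coeff /= !big_nat_recr //= big_nil.
  rewrite fact0 !factS fact0 !muln1 expr0 expr1 !divr1.
  by rewrite add0r.
apply: nondecreasing_cvgn_le (is_cvg_series_exp_coeff x) _.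
apply/nondecreasing_seqP => n; rewrite seriesS lerDr.
by rewrite /exp_coeff divr_ge0 ?exprn_ge0 ?ler0n.
Qed.

Lemma expRB1_gt0 x : 0 < x -> 0 < expR x - 1.
Proof. by move=> x0; rewrite subr_gt0 expR_gt1. Qed.

Lemma bose_gt0 x : 0 < x -> 0 < bose x.
Proof. by move=> x0; rewrite invr_gt0 expRB1_gt0. Qed.

Lemma boseE x : 0 < x -> bose x = expR (- x) / (1 - expR (- x)).
Proof.
move=> x0; have := expRB1_gt0 x0; have := expR_gt0 x => e0 e1.
by rewrite /bose expRN; field; rewrite !gt_eqF.
Qed.

Lemma mulr_bose_le x : 0 < x -> x * bose x <= 6 / (1 + x) ^+ 2.
Proof.
move=> x0; have e := expR_ge_cubic (ltW x0).
rewrite /bose -/(x / _) ler_pdivrMr ?expRB1_gt0 // mulrAC ler_pdivlMr; last first.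
  by rewrite exprn_gt0 // ltr_pwDr.
apply: (@le_trans _ _ (6 * (1 + x + x ^+ 2 / 2 + x ^+ 3 / 6 - 1))); last first.
  by rewrite ler_pM2l // lerD2r.
rewrite -subr_ge0; have -> : 6 * (1 + x + x ^+ 2 / 2 + x ^+ 3 / 6 - 1) -
  x * (1 + x) ^+ 2 = x ^+ 2 + 5 * x by field.
by rewrite addr_ge0 ?sqr_ge0 // mulr_ge0 // ltW.
Qed.

(** A bound on the slope of [bose], hence on the curvature of [logpart]: of order x^(-2) near 0,
    with one further power of decay at infinity. *)
Lemma bose_le_subr x y : 0 < x -> x <= y ->
  bose x - bose y <= 6 * (y - x) / (x ^+ 2 * (1 + x)).
Proof.
move=> x0 xy; have y0 := lt_le_trans x0 xy.
have ex0 := expRB1_gt0 x0; have ey0 := expRB1_gt0 y0.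
have e1 : expR y - expR x <= expR y * (y - x).
  rewrite -[X in _ - expR X](subKr y) expRD.
  rewrite -[X in X - _]mulr1 -mulrBr ler_pM2l ?expR_gt0 //.
  have := expR_ge1Dx (- (y - x)); lra.
have e2 : expR x - 1 <= expR y - 1 by rewrite lerD2r ler_expR.
have e3 : x / (1 + x) <= (expR y - 1) / expR y.
  rewrite ler_pdivrMr ?ltr_pwDr // mulrAC ler_pdivlMr ?expR_gt0 //.
  have h : expR x * (1 - x) <= 1.
    have := expR_ge1Dx (- x); rewrite -(ler_pM2l (expR_gt0 x)) expRN mulfV ?gt_eqF //.
    exact: expR_gt0.
  have := expR_ge1Dx x; nra.
have -> : bose x - bose y = (expR y - expR x) / ((expR x - 1) * (expR y - 1)).
  by rewrite /bose; field; rewrite !gt_eqF.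
have c := expR_ge_cubic (ltW x0).
have c1 : x * (1 + x) ^+ 2 / 6 <= expR x - 1.
  apply: le_trans (_ : 1 + x + x ^+ 2 / 2 + x ^+ 3 / 6 - 1 <= _); last by rewrite lerD2r.
  rewrite -subr_ge0.
  have -> : 1 + x + x ^+ 2 / 2 + x ^+ 3 / 6 - 1 - x * (1 + x) ^+ 2 / 6 =
    (x ^+ 2 + 5 * x) / 6 by field.
  by rewrite divr_ge0 // addr_ge0 ?sqr_ge0 // mulr_ge0 // ltW.
have d0 : 0 <= y - x by rewrite subr_ge0.
have ey := expR_gt0 y.
have x1 : 0 < 1 + x by rewrite ltr_pwDr.
apply: (@le_trans _ _ ((y - x) / ((expR x - 1) * ((expR y - 1) / expR y)))).
  have -> : (y - x) / ((expR x - 1) * ((expR y - 1) / expR y)) =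
    (expR y * (y - x)) / ((expR x - 1) * (expR y - 1)).
    by field; rewrite !gt_eqF.
  by rewrite ler_pM2r // invr_gt0 mulr_gt0.
have -> : 6 * (y - x) / (x ^+ 2 * (1 + x)) =
  (y - x) / ((x * (1 + x) ^+ 2 / 6) * (x / (1 + x))).
  by field; rewrite !gt_eqF.
rewrite ler_wpM2l // lef_pV2 ?posrE.
- by apply: ler_pM => //; rewrite ?divr_ge0 ?mulr_ge0 ?exprn_ge0 // ltW.
- by rewrite mulr_gt0 // divr_gt0.
- by apply: mulr_gt0; apply: divr_gt0 => //; rewrite mulr_gt0 ?exprn_gt0.
Qed.

(** Tangent inequality of the convex function [logpart], with the slope taken at [x - d]; it comes
    from [ln q <= q - 1] for the quotient of the two geometric sums. *)
Lemma logpart_subr_le x d : 0 < x -> d < x ->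
  logpart (x - d) - logpart x <= d * bose (x - d).
Proof.
move=> x0 dx; have xd0 : 0 < x - d by rewrite subr_gt0.
have a0 : 0 < 1 - expR (- x) by rewrite subr_gt0 expR_lt1 oppr_lt0.
have b0 : 0 < 1 - expR (- (x - d)) by rewrite subr_gt0 expR_lt1 oppr_lt0.
have -> : logpart (x - d) - logpart x =
  ln ((1 - expR (- x)) / (1 - expR (- (x - d)))).
  by rewrite /logpart ln_div ?posrE //; ring.
apply: le_trans (_ : (1 - expR (- x)) / (1 - expR (- (x - d))) - 1 <= _).
  set q := _ / _; have q0 : 0 < q by rewrite divr_gt0.
  by have := expR_ge1Dx (ln q); rewrite lnK // => h; rewrite lerBrDl.
rewrite boseE // mulrA ler_pdivlMr // mulrBl mul1r divfK ?gt_eqF //.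
have -> : expR (- x) = expR (- (x - d)) * expR (- d) by rewrite -expRD; congr expR; ring.
have := expR_ge1Dx (- d); have := expR_gt0 (- (x - d)); nra.
Qed.

Lemma logpart_subr_ge x d : 0 < x -> d < x ->
  d * bose x <= logpart (x - d) - logpart x.
Proof.
move=> x0 dx; have xd0 : 0 < x - d by rewrite subr_gt0.
(* The same inequality with the roles of the two points exchanged. *)
have := @logpart_subr_le (x - d) (- d) xd0; rewrite opprK subrK => h.
have : - d < x - d by lra.
move=> /h; lra.
Qed.

(** Second-order Taylor bound. For [d >= 0] the curvature is evaluated at [x - d >= x / 2], which
    costs 2^2 * 2 on the constant 6 of [bose_le_subr] and gives 48. A tilt relative to [x] leaves
    the remainder summable over the modes. *)
Lemma logpart_subr_quad x d kap : 0 < x -> kap <= 2^-1 -> `|d| <= kap * x ->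
  logpart (x - d) - logpart x <= d * bose x + 48 * kap ^+ 2 / (1 + x).
Proof.
move=> x0 kap2 dk.
have dx2 : `|d| <= x / 2.
  by apply: le_trans dk _; rewrite mulrC ler_pM2l.
have dx : d < x by have := ler_norm d; lra.
apply: le_trans (logpart_subr_le x0 dx) _.
rewrite -lerBlDl -mulrBr.
have d2 : d ^+ 2 <= kap ^+ 2 * x ^+ 2.
  by rewrite -exprMn -[d ^+ 2]real_normK ?num_real // ler_pXn2r // ?nnegrE // (le_trans _ dk).
have x1 : 0 < 1 + x by lra.
have [d0|d0] := leP 0 d.
  have u0 : 0 < x - d by lra.
  have u2 : x / 2 <= x - d by rewrite ger0_norm // in dx2; lra.
  apply: (@le_trans _ _ (d * (6 * d / ((x - d) ^+ 2 * (1 + (x - d)))))).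
    rewrite ler_wpM2l //.
    by have := @bose_le_subr (x - d) x u0; rewrite subKr; apply; lra.
  apply: (@le_trans _ _ (d * (6 * d / ((x / 2) ^+ 2 * ((1 + x) / 2))))).
    rewrite ler_wpM2l // ler_wpM2l ?mulr_ge0 // lef_pV2 ?posrE.
    - apply: ler_pM; rewrite ?sqr_ge0 //; try lra.
      by rewrite ler_pXn2r ?nnegrE //; lra.
    - by rewrite mulr_gt0 ?exprn_gt0 //; lra.
    - by rewrite mulr_gt0 ?exprn_gt0 //; lra.
  have -> : d * (6 * d / ((x / 2) ^+ 2 * ((1 + x) / 2))) =
    (48 * d ^+ 2) / (x ^+ 2 * (1 + x)) by field; rewrite !gt_eqF.
  rewrite invfM mulrA ler_pM2r ?invr_gt0 // ler_pdivrMr ?exprn_gt0 //.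
  by rewrite -mulrA ler_pM2l.
have -> : d * (bose (x - d) - bose x) = - d * (bose x - bose (x - d)) by ring.
apply: (@le_trans _ _ (- d * (6 * - d / (x ^+ 2 * (1 + x))))).
  rewrite ler_wpM2l //; first by lra.
  have := @bose_le_subr x (x - d) x0.
  have -> : x - d - x = - d by ring.
  by apply; lra.
have -> : - d * (6 * - d / (x ^+ 2 * (1 + x))) =
  (6 * d ^+ 2) / (x ^+ 2 * (1 + x)) by field; rewrite !gt_eqF.
rewrite invfM mulrA ler_pM2r ?invr_gt0 // ler_pdivrMr ?exprn_gt0 //.
have := sqr_ge0 d; nra.
Qed.

(** Bernoulli's inequality for the power [1 + kap] of [expR x]; it measures how far cooling lowers
    the mean energy. *)
Lemma boseMl x kap : 0 < x -> 0 <= kap ->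
  bose ((1 + kap) * x) <= bose x / (1 + kap).
Proof.
move=> x0 k0; have k1 : 0 < 1 + kap by lra.
rewrite /bose -invfM lef_pV2 ?posrE ?mulr_gt0 ?expRB1_gt0 ?mulr_gt0 //.
have -> : (1 + kap) * x = x + kap * x by ring.
rewrite expRD.
have h : expR x * (1 - x) <= 1.
  have := expR_ge1Dx (- x); rewrite -(ler_pM2l (expR_gt0 x)) expRN mulfV ?gt_eqF //.
  exact: expR_gt0.
have := expR_ge1Dx (kap * x); rewrite -(ler_pM2l (expR_gt0 x)).
have : kap * (expR x * (1 - x)) <= kap * 1 by rewrite ler_wpM2l.
lra.
Qed.

End bose.

(** * Exponential sums over finite boxes *)

Section boltzmann.
Context {R : realType} (n : nat).
Implicit Types (y d : nat -> R).

(** The cap [M] on the multiplicities makes all sums finite; where the full partition function is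
    wanted, [M] tends to infinity. *)
Definition lin y (M : nat) (m : {ffun 'I_n -> 'I_M.+1}) : R :=
  \sum_(k < n) y k * (m k)%:R.

Lemma expR_logpart (x : R) : 0 < x -> expR (logpart x) = (1 - expR (- x))^-1.
Proof.
by move=> x0; rewrite /logpart expRN lnK // posrE subr_gt0 expR_lt1 oppr_lt0.
Qed.

Lemma sum_expR_lin M y :
  \sum_(m : {ffun 'I_n -> 'I_M.+1}) expR (- lin y m) =
  \prod_(k < n) \sum_(i < M.+1) expR (- y k) ^+ i.
Proof.
rewrite bigA_distr_bigA /=; apply: eq_bigr => m _.
rewrite /lin -sumrN expR_sum; apply: eq_bigr => k _.
by rewrite -mulNr expRM_natr.
Qed.

Lemma geom_sumE (x : R) M : x < 1 ->
  \sum_(i < M.+1) x ^+ i = (1 - x ^+ M.+1) / (1 - x).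
Proof.
move=> x1; have := subrX1 x M.+1 => /eqP e.
have x10 : 1 - x != 0 by rewrite subr_eq0 gt_eqF.
apply: (mulIf x10); rewrite divfK // mulrC -[1 - x]opprB mulNr.
by rewrite -(eqP e) opprB.
Qed.

Lemma sum_expR_lin_le M y : (forall k, (k < n)%N -> 0 < y k) ->
  \sum_(m : {ffun 'I_n -> 'I_M.+1}) expR (- lin y m) <=
  expR (\sum_(k < n) logpart (y k)).
Proof.
move=> y0; rewrite sum_expR_lin expR_sum; apply: ler_prod => k _.
rewrite expR_logpart ?y0 // sumr_ge0 /=; last first.
  by move=> i _; rewrite exprn_ge0 // expR_ge0.
have x1 : expR (- y k) < 1 by rewrite expR_lt1 oppr_lt0 y0.
by rewrite geom_sumE // ler_pdivrMr ?subr_gt0 // mulVf ?subr_eq0 ?gt_eqF.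
Qed.

Lemma sum_expR_lin_cvg y : (forall k, (k < n)%N -> 0 < y k) ->
  (fun M => \sum_(m : {ffun 'I_n -> 'I_M.+1}) expR (- lin y m)) @ \oo -->
  expR (\sum_(k < n) logpart (y k)).
Proof.
move=> y0; under eq_fun do rewrite sum_expR_lin.
rewrite expR_sum; apply: cvg_big => [|k _]; first by apply: mul_continuous.
rewrite expR_logpart ?y0 //.
have x1 : expR (- y k) < 1 by rewrite expR_lt1 oppr_lt0 y0.
under eq_fun do rewrite geom_sumE //.
have c : (1 - expR (- y k) ^+ M.+1) / (1 - expR (- y k)) @[M --> \oo] -->
    (1 - 0) / (1 - expR (- y k)).
  apply: cvgMl; apply: cvgB; first exact: cvg_cst.
  rewrite (cvg_shiftS (fun M => expR (- y k) ^+ M)); apply: cvg_expr.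
  by rewrite ger0_norm // expR_ge0.
by rewrite subr0 mul1r in c.
Qed.

(** Markov's inequality for an exponential moment: on [P] the factor [expR (lin d m - A)] is at
    least 1 and turns the weights [y] into [y - d]; the sum is then extended to the whole box. *)
Lemma tilted_sum_le M y d (A : R) (P : pred {ffun 'I_n -> 'I_M.+1}) :
  (forall k, (k < n)%N -> 0 < y k - d k) ->
  (forall m, P m -> A <= lin d m) ->
  \sum_(m | P m) expR (- lin y m) <=
  expR (- A + \sum_(k < n) logpart (y k - d k)).
Proof.
move=> yd PA; rewrite expRD.
apply: le_trans (_ : expR (- A) * \sum_(m : {ffun 'I_n -> 'I_M.+1})
    expR (- lin (fun k => y k - d k) m) <= _).
  rewrite mulr_sumr [leRHS](bigID P) /= -[leLHS]addr0; apply: lerD.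
    apply: ler_sum => m Pm; rewrite -expRD ler_expR.
    have -> : lin (fun k => y k - d k) m = lin y m - lin d m.
      by rewrite /lin -sumrB; apply: eq_bigr => k _; rewrite mulrBl.
    by have := PA m Pm; lra.
  by apply: sumr_ge0 => m _; rewrite mulr_ge0 // expR_ge0.
by rewrite ler_pM2l ?expR_gt0 //; exact: sum_expR_lin_le.
Qed.

End boltzmann.

(** * A lower bound for the number of solutions *)

(* The Boltzmann weights at inverse temperature [s (1 + kap)] put at least half
   of their mass on the energies in [[(1 - del) n, n]]: both tails are estimated
   by tilting, and [p n] controls the remaining mass up to a factor [n + 1]. *)
Lemma partition_lower_bound (R : realType) (n p : nat) (w : nat -> nat)
    (s kap del S Q : R) :
  (forall k, 0 < w k)%N ->
  (forall M (P : pred {ffun 'I_n -> 'I_M.+1}),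
    (forall m, P m -> \sum_(k < n) w k * m k <= n)%N -> (#|P| <= n.+1 * p)%N) ->
  0 < s -> 0 < kap -> kap <= 4^-1 ->
  S = \sum_(k < n) (w k)%:R * bose (s * (w k)%:R) ->
  Q = \sum_(k < n) (1 + s * (w k)%:R)^-1 ->
  - (kap / 2) * s * (n%:R - S / (1 + kap / 2)) <= - ln 4 ->
  kap * s * (1 - del) * n%:R - kap * s * S + 192 * kap ^+ 2 * Q <= - ln 4 ->
  expR (s * (1 + kap) * (1 - del) * n%:R + \sum_(k < n) logpart (s * (w k)%:R)
        - kap * s * S) <= 2 * (n.+1)%:R * p%:R.
Proof.
move=> w0 cnt s0 k0 k4 SE QE up lo.
set s' := s * (1 + kap).
have s'0 : 0 < s' by rewrite mulr_gt0 //; lra.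
have wR k : 0 < (w k)%:R :> R by rewrite ltr0n.
pose x k : R := s * (w k)%:R.
have x0 k : 0 < x k by rewrite mulr_gt0.
pose y k : R := s' * (w k)%:R.
have y0 k : 0 < y k by rewrite mulr_gt0.
have yx k : y k = x k - - (kap * x k) by rewrite /y /s' /x; ring.
set F0 := \sum_(k < n) logpart (x k).
set F1 := \sum_(k < n) logpart (y k).
(* By convexity of [logpart], cooling lowers the log partition function by at most its first-order
   term. *)
have F10 : F0 - kap * s * S <= F1.
  rewrite -lerBrDl SE -mulrN -sumrN mulr_sumr /F1 /F0 -sumrB.
  apply: ler_sum => k _; rewrite yx.
  apply: le_trans (logpart_subr_ge (x0 k) _); last first.
    by rewrite -subr_gt0 opprK addr_gt0 // mulr_gt0.
  by rewrite /x le_eqVlt; apply/orP; left; apply/eqP; ring.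
have lin_nat M (m : {ffun 'I_n -> 'I_M.+1}) :
    lin (fun k => (w k)%:R) m = (\sum_(k < n) w k * m k)%N%:R :> R.
  by rewrite /lin natr_sum; apply: eq_bigr => k _; rewrite natrM.
have linZ (a : R) M (m : {ffun 'I_n -> 'I_M.+1}) :
    lin (fun k => a * (w k)%:R) m = a * lin (fun k => (w k)%:R) m.
  by rewrite /lin mulr_sumr; apply: eq_bigr => k _; rewrite mulrA.
have ln4 : expR (- ln 4) = 4^-1 :> R by rewrite expRN lnK // posrE.
pose E M (m : {ffun 'I_n -> 'I_M.+1}) : R := lin (fun k => (w k)%:R) m.
(* The tilt heats the system halfway back, to inverse temperature [s * (1 + kap / 2)], where
   [boseMl] bounds the mean energy by [S / (1 + kap / 2)]. *)
have upper M : \sum_(m | n%:R < @E M m)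
    expR (- lin y m) <= expR F1 / 4.
  apply: (@le_trans _ _ (expR (- (kap / 2 * s * n%:R) +
      \sum_(k < n) logpart (y k - kap / 2 * s * (w k)%:R)))).
    apply: (@tilted_sum_le _ _ _ _ (fun k => kap / 2 * s * (w k)%:R)) => [k _|m /ltW nm].
      have -> : y k - kap / 2 * s * (w k)%:R = (1 + kap / 2) * x k.
        by rewrite /y /s' /x; field.
      by rewrite mulr_gt0 //; lra.
    by rewrite linZ ler_pM2l // !mulr_gt0 //; lra.
  rewrite -ln4 -expRD ler_expR [leRHS]addrC -lerBlDr -addrA.
  apply: le_trans up; rewrite /F1 -sumrB.
  have -> : - (kap / 2) * s * (n%:R - S / (1 + kap / 2)) =
    - (kap / 2 * s * n%:R) + (kap / 2) * s * (S / (1 + kap / 2)) by ring.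
  rewrite lerD2l SE mulr_suml mulr_sumr; apply: ler_sum => k _.
  have yk : 0 < y k - kap / 2 * s * (w k)%:R.
    have -> : y k - kap / 2 * s * (w k)%:R = (1 + kap / 2) * x k.
      by rewrite /y /s' /x; field.
    by rewrite mulr_gt0 //; lra.
  apply: le_trans (logpart_subr_le (y0 k) _) _; first by rewrite -subr_gt0.
  have -> : y k - kap / 2 * s * (w k)%:R = (1 + kap / 2) * x k.
    by rewrite /y /s' /x; field.
  have := @boseMl _ (x k) (kap / 2) (x0 k) _.
  have k20 : 0 <= kap / 2 by lra.
  move=> /(_ k20) h.
  rewrite -!mulrA ler_pM2l; last by lra.
  by rewrite ler_pM2l ?invr_gt0 // ler_pM2l // ler_pM2l.
(* The tilt cools further, to [s * (1 + 2 * kap)]. Expanding around [s] with relative step [2 * kap]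
   gives the remainder 48 * (2 kap)^2 = 192 kap^2 per mode. *)
have lower M : \sum_(m | @E M m < (1 - del) * n%:R)
    expR (- lin y m) <= expR F1 / 4.
  apply: (@le_trans _ _ (expR (- (- (kap * s) * ((1 - del) * n%:R)) +
      \sum_(k < n) logpart (y k - - (kap * s) * (w k)%:R)))).
    apply: (@tilted_sum_le _ _ _ _ (fun k => - (kap * s) * (w k)%:R)) => [k _|m /ltW nm].
      have -> : y k - - (kap * s) * (w k)%:R = (1 + 2 * kap) * x k.
        by rewrite /y /s' /x; ring.
      by rewrite mulr_gt0 //; lra.
    by rewrite linZ !mulNr lerN2 ler_pM2l // !mulr_gt0.
  rewrite -ln4 -expRD ler_expR.
  apply: (@le_trans _ _ (kap * s * (1 - del) * n%:R +
      (F0 - 2 * kap * s * S + 192 * kap ^+ 2 * Q))); last by move: lo F10; lra.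
  have -> : - (- (kap * s) * ((1 - del) * n%:R)) = kap * s * (1 - del) * n%:R by ring.
  rewrite lerD2l -addrA -lerBlDl /F0 -sumrB SE QE !mulr_sumr.
  rewrite -sumrN -big_split /= ler_sum // => k _.
  have -> : y k - - (kap * s) * (w k)%:R = x k - (- (2 * kap * x k)).
    by rewrite /y /s' /x; ring.
  apply: le_trans (logpart_subr_quad (x0 k) (kap := 2 * kap) _ _) _.
  - by lra.
  - by rewrite normrN ger0_norm // !mulr_ge0 // ltW.
  by rewrite /x le_eqVlt; apply/orP; left; apply/eqP; ring.
(* Each tail carries at most a quarter of the mass; in between, every weight is at most its value at
   energy [(1 - del) * n], and [cnt] bounds the number of terms. *)
have main M : \sum_(m : {ffun 'I_n -> 'I_M.+1}) expR (- lin y m) <=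
    expR F1 / 2 + (n.+1)%:R * p%:R * expR (- (s' * ((1 - del) * n%:R))).
  rewrite (bigID (fun m : {ffun 'I_n -> 'I_M.+1} => n%:R < E M m)) /=.
  rewrite [X in _ + X](bigID (fun m : {ffun 'I_n -> 'I_M.+1} => E M m < (1 - del) * n%:R)) /=.
  have -> : expR F1 / 2 = expR F1 / 4 + expR F1 / 4 by field.
  rewrite -addrA; apply: lerD; first exact: upper.
  apply: lerD.
    apply: le_trans (lower M).
    rewrite [leRHS](bigID (fun m : {ffun 'I_n -> 'I_M.+1} => ~~ (n%:R < E M m))) /=.
    rewrite (eq_bigl _ _ (fun m => andbC _ _)) lerDl.
    by apply: sumr_ge0 => m _; exact: expR_ge0.
  pose P (m : {ffun 'I_n -> 'I_M.+1}) := ~~ (n%:R < E M m) && ~~ (E M m < (1 - del) * n%:R).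
  apply: (@le_trans _ _ (\sum_(m | P m) expR (- (s' * ((1 - del) * n%:R))))).
    apply: ler_sum => m /andP[_]; rewrite -leNgt => h.
    by rewrite ler_expR lerN2 /y linZ ler_pM2l.
  rewrite sumr_const -[X in X <= _]mulr_natl ler_wpM2r ?expR_ge0 //.
  rewrite -natrM ler_nat; apply: cnt => m /andP[+ _].
  by rewrite -leNgt /E lin_nat ler_nat.
(* The right-hand side of [main] is free of [M], so the box may be exhausted. *)
have : expR F1 <= expR F1 / 2 + (n.+1)%:R * p%:R * expR (- (s' * ((1 - del) * n%:R))).
  have c := @sum_expR_lin_cvg R n y (fun k _ => y0 k).
  rewrite -(cvg_lim _ c) //; apply: limr_le; first by apply/cvg_ex; eexists; exact: c.
  by near=> M; rewrite (cvg_lim _ c) //; exact: main.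
rewrite expRN => h.
have h2 : expR F1 <= 2 * (n.+1)%:R * p%:R / expR (s' * ((1 - del) * n%:R)) by lra.
rewrite ler_pdivlMr ?expR_gt0 // -expRD in h2.
apply: le_trans h2; rewrite ler_expR.
by move: F10; rewrite /s'; lra.
Unshelve. all: by end_near.
Qed.

(** * Riemann sums with varying integrand *)

Section riemann.
Context {R : realType}.
Local Notation mu := (@lebesgue_measure R).
Local Notation Rpos := (`[(0:R), +oo[%classic : set R).

Definition cell (b : R) (k : nat) : set R := `[k%:R / b, k.+1%:R / b[%classic.

Lemma cellP (b y : R) k : 0 < b -> cell b k y <-> k%:R <= b * y < k.+1%:R.
Proof.
move=> b0; rewrite /cell /= in_itv /= ler_pdivrMr // ltr_pdivlMr //.
by rewrite ![y * b]mulrC.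
Qed.

Lemma cell_truncn (b y : R) k : 0 < b -> 0 <= y ->
  cell b k y <-> k = Num.truncn (b * y).
Proof.
move=> b0 y0; rewrite cellP //; split=> [/andP[h1 h2]|->].
  by apply/esym/truncn_def; rewrite h1.
by apply: truncn_itv; rewrite mulr_ge0 // ltW.
Qed.

Definition stepfun (b : R) (n : nat) (h : nat -> R) (y : R) : R :=
  \sum_(k < n) h k * \1_(cell b k) y.

Lemma stepfunE b n h y : 0 < b -> 0 <= y ->
  stepfun b n h y =
  if (Num.truncn (b * y) < n)%N then h (Num.truncn (b * y)) else 0.
Proof.
move=> b0 y0; rewrite /stepfun; set t := Num.truncn _.
have E (k : nat) : \1_(cell b k) y = (k == t)%:R :> R.
  rewrite indicE; congr (nat_of_bool _)%:R; apply/idP/eqP.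
    by rewrite inE cell_truncn.
  by move=> e; rewrite inE cell_truncn.
case: ifPn => tn.
  rewrite (bigD1 (Ordinal tn)) //= E eqxx mulr1 big1 ?addr0 // => k.
  by rewrite -val_eqE /= => /negPf kt; rewrite E kt mulr0.
rewrite big1 // => k _; rewrite E; case: eqP => e; last by rewrite mulr0.
by move: tn; rewrite -e ltn_ord.
Qed.

Lemma measurable_stepfun b n h : measurable_fun setT (stepfun b n h).
Proof.
apply: measurable_sum => k; apply: measurable_funM => //.
by apply: measurable_indic; exact: measurable_itv.
Qed.

Lemma integral_stepfun b n h : 0 < b -> (forall k, 0 <= h k) ->
  (\int[mu]_(y in `[0%R, +oo[) (stepfun b n h y)%:E =
   (b^-1 * \sum_(k < n) h k)%:E)%E.
Proof.
move=> b0 h0; rewrite /stepfun.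
under eq_integral do rewrite -sumEFin.
rewrite ge0_integral_sum //=; last 2 first.
- move=> k; apply/measurable_EFinP; apply: measurable_funM => //.
  by apply: measurable_indic; exact: measurable_itv.
- by move=> k y _; rewrite lee_fin mulr_ge0.
rewrite mulr_sumr -sumEFin; apply: eq_bigr => k _.
under eq_integral do rewrite EFinM.
rewrite ge0_integralZl //=; last 2 first.
- by apply/measurable_EFinP; apply: measurable_indic; apply: measurable_itv.
- by rewrite lee_fin.
rewrite integral_indic //=; last exact: measurable_itv.
rewrite setIidl; last first.
  move=> y; rewrite /cell /=; rewrite !in_itv /= andbT => /andP[+ _].
  by apply: le_trans; rewrite divr_ge0 // ltW.
rewrite lebesgue_measure_itv /= lte_fin ltr_pM2r ?invr_gt0 // ltr_nat ltnSn.
by rewrite -EFinB -mulrBl -natrB // subSnn mul1r -EFinM mulrC.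
Qed.

(** The scaled sum is the integral of a step function, to which dominated convergence applies. The
    exceptional point [a] allows for the place where a truncated range of summation begins. The case
    n = 0 is set apart because [scale 0] vanishes. *)
Lemma cvg_riemann_sum (b : nat -> R) (h : nat -> nat -> R) (g D : R -> R)
    (a : R) :
  (forall n, (0 < n)%N -> 0 < b n) -> (forall n k, 0 <= h n k) ->
  (forall n k y, (0 < n)%N -> 0 <= y -> k%:R <= b n * y < k.+1%:R -> h n k <= D y) ->
  (forall y, 0 <= D y) ->
  mu.-integrable Rpos (EFin \o D) ->
  measurable_fun Rpos g ->
  (forall y, 0 < y -> y != a ->
    (if (Num.truncn (b n * y) < n)%N then h n (Num.truncn (b n * y)) else 0)
      @[n --> \oo] --> g y) ->
  mu.-integrable Rpos (EFin \o g) /\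
  (b n)^-1 * \sum_(k < n) h n k @[n --> \oo] --> \int[mu]_(y in `[0%R, +oo[) g y.
Proof.
move=> b0 h0 hD D0 iD mg hg.
pose f n y := (stepfun (b n) n (h n) y)%:E.
have mD : measurable Rpos by exact: measurable_itv.
have [ig _ cg] : [/\ mu.-integrable Rpos (EFin \o g),
   (\int[mu]_(x in `[0%R, +oo[) (`|f n x - (g x)%:E|))%E @[n --> \oo] --> 0%E &
   (\int[mu]_(x in `[0%R, +oo[) f n x)%E @[n --> \oo] -->
     (\int[mu]_(x in `[0%R, +oo[) (g x)%:E)%E].
  apply: (@dominated_convergence _ _ _ mu _ mD f (EFin \o g) (EFin \o D)) => //.
  - move=> n; apply/measurable_EFinP.
    exact: measurable_funS (measurable_stepfun _ _ _).
  - exact/measurable_EFinP.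
  - have neg : mu.-negligible [set 0%R; a].
      apply: negligibleU.
        by exists [set 0%R]; split => //; exact: lebesgue_measure_set1.
      by exists [set a]; split => //; exact: lebesgue_measure_set1.
    apply: negligibleS neg => y /= /not_implyP[] /=.
    rewrite in_itv /= andbT => y0 ny; apply: contrapT => /not_orP[/eqP yn0 /eqP yna].
    apply: ny; have y0' : 0 < y by rewrite lt_neqAle eq_sym yn0.
    apply: cvg_EFin; first by near=> n.
    apply: cvg_trans (hg y y0' yna); apply: near_eq_cvg.
    near=> n; rewrite /= stepfunE //; apply: b0.
    by near: n; exact: nbhs_infty_gt.
  - apply: aeW => y n /=; rewrite in_itv /= andbT => y0.
    rewrite lee_fin; case: n => [|n].
      by rewrite /stepfun big_ord0 normr0.
    rewrite stepfunE ?b0 //; case: ifPn => _; last by rewrite normr0.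
    rewrite ger0_norm //; apply: hD => //; apply: truncn_itv.
    by rewrite mulr_ge0 // ltW // b0.
split => //; rewrite /Rintegral.
move: (cg); have fin : (\int[mu]_(x in `[0%R, +oo[) (g x)%:E)%E \is a fin_num.
  exact: integrable_fin_num.
rewrite -[X in _ --> X -> _](fineK fin) => /fine_cvg.
apply: cvg_trans; apply: near_eq_cvg; near=> n.
rewrite /= /f integral_stepfun //; apply: b0.
by near: n; exact: nbhs_infty_gt.
Unshelve. all: by end_near.
Qed.

Lemma integrable_inv1Dsqr (C : R) :
  mu.-integrable Rpos (fun y => (C * (1 + y ^+ 2)^-1)%:E).
Proof.
have i1 : mu.-integrable Rpos (fun y => ((oneDsqr y)^-1)%:E).
  apply/integrableP; split.
    apply/measurable_EFinP; apply: measurable_funTS.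
    exact: continuous_measurable_fun continuous_oneDsqrV.
  under eq_integral => y _ do
    rewrite gee0_abs ?lee_fin ?invr_ge0 //.
  by rewrite integral0y_oneDsqr ltry.
have := @integrableZl _ _ _ mu _ (measurable_itv `[(0:R), +oo[) C _ i1.
by apply: eq_integrable => // y _.
Qed.

End riemann.

(** * The Bose-Einstein integral *)

Section bose_integral.
Context {R : realType}.
Local Notation mu := (@lebesgue_measure R).
Local Notation Rpos := (`](0:R), +oo[%classic : set R).

Lemma measurable_bose_comp (D : set R) (p : R -> R) : measurable D ->
  measurable_fun D p -> (forall y, D y -> 0 <= p y) ->
  measurable_fun D (fun y => bose (p y)).
Proof.
(* The inverse is the real power -1, since [p >= 0] makes its base nonnegative; real powers are
   measurable. *)
move=> mD mp p0; apply: (eq_measurable_fun (fun y => (expR (p y) - 1) `^ (- 1))).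
  move=> y; rewrite inE => Dy; rewrite powR_inv1 // subr_ge0.
  by rewrite -expR0 ler_expR p0.
apply: (measurableT_comp (measurable_powR (- 1))).
apply: measurable_funB => //; exact: measurableT_comp.
Qed.

Lemma bigcup_itv_pos : \bigcup_m `[(m.+1%:R : R)^-1, m.+1%:R]%classic = Rpos.
Proof.
apply/seteqP; split => y /=.
  move=> [m _] /=; rewrite !in_itv /= andbT => /andP[+ _].
  by apply: lt_le_trans; rewrite invr_gt0.
rewrite in_itv /= andbT => y0; exists (Num.truncn (y + y^-1)) => //=.
have h : y + y^-1 < (Num.truncn (y + y^-1)).+1%:R by exact: truncnS_gt.
have yV : 0 < y^-1 by rewrite invr_gt0.
rewrite in_itv /=; apply/andP; split; last by apply: ltW; lra.
by rewrite -[leRHS]invrK lef_pV2 ?posrE //; lra.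
Qed.

(** The images of the previous intervals under u = kap y^r again exhaust the positive axis; the
    index is chosen above both a point and its inverse. *)
Lemma bigcup_itv_pow (kap : R) (r : nat) : 0 < kap -> (0 < r)%N ->
  \bigcup_m `[kap * (m.+1%:R)^-1 ^+ r, kap * m.+1%:R ^+ r]%classic = Rpos.
Proof.
move=> k0 r0; apply/seteqP; split => y /=.
  move=> [m _] /=; rewrite !in_itv /= andbT => /andP[+ _].
  by apply: lt_le_trans; rewrite mulr_gt0 // exprn_gt0 // invr_gt0.
rewrite in_itv /= andbT => y0.
set z := y / kap; have z0 : 0 < z by rewrite divr_gt0.
have yz : y = kap * z by rewrite /z mulrC divfK // gt_eqF.
exists (Num.truncn (z + z^-1)) => //=.
have h : z + z^-1 < (Num.truncn (z + z^-1)).+1%:R by exact: truncnS_gt.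
set M : R := _.+1%:R in h *.
have zV : 0 < z^-1 by rewrite invr_gt0.
have M1 : 1 <= M by rewrite /M ler1n.
have MM : M <= M ^+ r by rewrite -[leLHS]expr1 ler_weXn2l.
rewrite in_itv /= yz !ler_pM2l //; apply/andP; split; last by lra.
rewrite exprVn -[leRHS]invrK lef_pV2 ?posrE //; last by rewrite exprn_gt0 //; lra.
by lra.
Qed.

(** Euler's integral for Gamma(1 + p), extended-real valued because its finiteness is deduced only
    later, from [boseint_fin]. *)
Definition gammaint (p : R) : \bar R :=
  (\int[mu]_(u in Rpos) (u `^ p * expR (- u))%:E)%E.

Definition powexp (r : nat) (kap y : R) : R := y ^+ r * expR (- (kap * y ^+ r)).

Lemma powexp_ge0 r kap y : 0 <= y -> 0 <= powexp r kap y.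
Proof. by move=> y0; rewrite mulr_ge0 ?expR_ge0 ?exprn_ge0. Qed.

Lemma measurable_powexp r kap D : measurable D -> measurable_fun D (powexp r kap).
Proof.
move=> mD; apply: measurable_funM; first exact: measurable_funX.
apply: measurableT_comp => //; apply: measurableT_comp => //.
by apply: measurable_funM => //; exact: measurable_funX.
Qed.

(** Substitution u = kap y^r on compact intervals away from 0, followed by monotone convergence on
    both sides. *)
Lemma gammaint_subst (r : nat) (kap : R) : (0 < r)%N -> 0 < kap ->
  gammaint r%:R^-1 = ((r%:R * kap `^ (1 + r%:R^-1))%:E *
    \int[mu]_(y in Rpos) (powexp r kap y)%:E)%E.
Proof.
move=> r0 k0; pose p : R := r%:R^-1.
have rR : (r%:R : R) != 0 by rewrite pnatr_eq0 -lt0n.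
pose F (y : R) := kap * y ^+ r.
pose G (u : R) := u `^ p * expR (- u).
have dF y v : derivable F y v.
  by apply: derivableM => //; exact: exprn_derivable.
have F'E : F^`()%classic = fun y => kap * (r%:R * y ^+ r.-1).
  apply/funext => y; rewrite derive1E /F deriveMl ?exp_derive; last exact: exprn_derivable.
  by rewrite /GRing.scale /= mulr1.
have cF : continuous F.
  move=> y; apply: cvgM; first exact: cvg_cst.
  exact: exprn_continuous.
have cF' : continuous F^`()%classic.
  rewrite F'E => y; apply: cvgM; first exact: cvg_cst.
  apply: cvgM; first exact: cvg_cst.
  exact: exprn_continuous.
have cG u : 0 < u -> {for u, continuous G}.
  move=> u0; have cp : {for u, continuous (fun x => x `^ p)}.
    apply: differentiable_continuous; apply/derivable1_diffP.
    by apply: derivable_powR; rewrite in_itv /= u0.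
  apply: cvgM; first exact: cp.
  apply: continuous_comp; first exact: continuousN.
  exact: continuous_expR.
have step m : (\int[mu]_(u in `[F (m.+1%:R)^-1%R, F m.+1%:R%R]) (G u)%:E =
    \int[mu]_(y in `[(m.+1%:R)^-1%R, m.+1%:R%R])
      (r%:R * kap `^ (1 + p) * powexp r kap y)%:E)%E.
  have ab : (m.+1%:R)^-1 <= m.+1%:R :> R.
    by apply: (@le_trans _ _ 1); rewrite ?invf_le1 ?ler1n.
  rewrite integration_by_substitution_increasing //; last first.
  - apply: continuous_in_subspaceT => u; rewrite inE /= in_itv /= => /andP[+ _].
    move=> h; apply: cG; apply: lt_le_trans h.
    by rewrite /F mulr_gt0 // exprn_gt0 // invr_gt0.
  - split.
    + by move=> y _; exact: dF.
    + by apply: cvg_at_right_filter; exact: cF.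
    + by apply: cvg_at_left_filter; exact: cF.
  - apply/cvg_ex; eexists; apply: cvg_at_left_filter; exact: cF'.
  - apply/cvg_ex; eexists; apply: cvg_at_right_filter; exact: cF'.
  - move=> x y; rewrite !in_itv /= => /andP[x1 _] _ xy.
    have x0 : 0 < x by apply: lt_le_trans x1; rewrite invr_gt0.
    by rewrite /F ltr_pM2l // ltrXn2r -?lt0n // ltW.
  apply: eq_integral => y; rewrite inE /= in_itv /= => /andP[y1 _].
  have y0 : 0 < y by apply: lt_le_trans y1; rewrite invr_gt0.
  congr EFin; rewrite /GRing.mul /= -!/(GRing.mul _ _) F'E /G /F /powexp.
  have -> : (kap * y ^+ r) `^ p = kap `^ p * y.
    rewrite powRM ?exprn_ge0 // ?ltW // -powR_mulrn ?ltW // -powRrM mulfV // powRr1 //.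
    exact: ltW.
  rewrite powRD; last by rewrite (gt_eqF k0) implybT.
  rewrite powRr1 ?ltW // -[in y ^+ r](prednK r0) exprS -(prednK r0) /=.
  by ring.
have ndF : nondecreasing_seq (fun m => `[(m.+1%:R : R)^-1, m.+1%:R]%classic).
  move=> m n mn; rewrite subsetEset => y /=; rewrite !in_itv /= => /andP[h1 h2].
  apply/andP; split; last by apply: le_trans h2 _; rewrite ler_nat.
  by apply: le_trans h1; rewrite lef_pV2 ?posrE // ler_nat.
have ndF2 : nondecreasing_seq (fun m => `[F (m.+1%:R)^-1, F m.+1%:R]%classic).
  move=> m n mn; rewrite subsetEset => y /=; rewrite !in_itv /= => /andP[h1 h2].
  apply/andP; split.
    apply: le_trans h1; rewrite /F ler_pM2l // lerXn2r ?nnegrE ?invr_ge0 //.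
    by rewrite lef_pV2 ?posrE // ler_nat.
  apply: le_trans h2 _; rewrite /F ler_pM2l // lerXn2r ?nnegrE //.
  by rewrite ler_nat.
have F0 m : 0 < F (m.+1%:R)^-1 by rewrite /F mulr_gt0 // exprn_gt0 // invr_gt0.
have C1 : (\int[mu]_(u in `[F (m.+1%:R)^-1%R, F m.+1%:R%R]) (G u)%:E)%E @[m --> \oo]
    --> gammaint p.
  rewrite /gammaint -(bigcup_itv_pow k0 r0).
  apply: ge0_nondecreasing_set_cvg_integral => //.
  - move=> m; apply/measurable_EFinP; apply: measurable_funM.
      exact: measurable_funTS (measurable_powR _).
    by apply: measurableT_comp.
  - by move=> m u _; rewrite lee_fin mulr_ge0 ?powR_ge0 ?expR_ge0.
have C2 : (\int[mu]_(y in `[(m.+1%:R)^-1%R, m.+1%:R%R])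
      (r%:R * kap `^ (1 + p) * powexp r kap y)%:E)%E @[m --> \oo] -->
    (\int[mu]_(y in Rpos) (r%:R * kap `^ (1 + p) * powexp r kap y)%:E)%E.
  rewrite -bigcup_itv_pos.
  apply: ge0_nondecreasing_set_cvg_integral => //.
  - move=> m; apply/measurable_EFinP; apply: measurable_funM => //.
    exact: measurable_powexp.
  - move=> m u /=; rewrite in_itv /= => /andP[h _].
    rewrite lee_fin mulr_ge0 ?mulr_ge0 ?powR_ge0 // ?exprn_ge0 // ?expR_ge0 //.
    by apply: le_trans h; rewrite invr_ge0.
rewrite (eq_cvg _ _ step) in C1.
rewrite -ge0_integralZl //=.
- exact: cvg_unique C1 C2.
- by apply/measurable_EFinP; exact: measurable_powexp.
- by move=> y; rewrite in_itv /= andbT => /ltW y0; rewrite lee_fin powexp_ge0.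
- by rewrite lee_fin mulr_ge0 // powR_ge0.
Qed.

Lemma gammaint_gt0 (p : R) : 0 < p -> (0%R < gammaint p)%E.
Proof.
move=> p0.
apply: (@lt_le_trans _ _ (\int[mu]_(u in `[1%R, 2%R]) (expR (- 2))%:E)%E).
  rewrite integral_cst //= lebesgue_measure_itv /= lte_fin ltr1n.
  by rewrite -EFinB -EFinM lte_fin mulr_gt0 ?expR_gt0 //; lra.
apply: (@le_trans _ _ (\int[mu]_(u in `[1%R, 2%R]) (u `^ p * expR (- u))%:E)%E).
  apply: ge0_le_integral => //.
  - apply/measurable_EFinP; apply: measurable_funM.
      exact: measurable_funTS (measurable_powR _).
    by apply: measurableT_comp.
  - move=> u /=; rewrite in_itv /= => /andP[u1 u2]; rewrite lee_fin.
    rewrite -[leLHS]mul1r ler_pM ?expR_ge0 // ?ler_expR ?lerN2 //.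
    by have := @ge0_ler_powR _ p (ltW p0) 1 u; rewrite powR1 !nnegrE; apply; lra.
apply: ge0_subset_integral => //.
- apply/measurable_EFinP; apply: measurable_funM.
    exact: measurable_funTS (measurable_powR _).
  by apply: measurableT_comp.
- by move=> u _; rewrite lee_fin mulr_ge0 ?powR_ge0 ?expR_ge0.
- by move=> u /=; rewrite !in_itv /= => /andP[+ _]; lra.
Qed.

Lemma bose_series (x : R) : 0 < x ->
  (\sum_(0 <= k <oo) (expR (- (k.+1%:R * x)))%:E = (bose x)%:E)%E.
Proof.
move=> x0; set q := expR (- x).
have q1 : q < 1 by rewrite expR_lt1 oppr_lt0.
have q0 : 0 <= q by exact: expR_ge0.
have qE k : expR (- (k.+1%:R * x)) = geometric q q k.
  by rewrite /geometric /= -mulrN expRM_natl exprS.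
under eq_eseriesr do rewrite qE.
have cv : series (geometric q q) @ \oo --> q / (1 - q).
  by apply: cvg_geometric_series; rewrite ger0_norm.
rewrite boseE //; apply/cvg_lim => //.
apply: cvg_trans (_ : (EFin \o series (geometric q q)) @ \oo --> (q / (1 - q))%:E).
  by apply: near_eq_cvg; near=> n; rewrite /= /series /= sumEFin.
exact: cvg_comp cv _.
Unshelve. all: by end_near. Qed.

(** At [a = c / r!] this is r! times the limit of the mean energy divided by n. *)
Definition boseint (r : nat) (a : R) : \bar R :=
  (\int[mu]_(y in Rpos) (y ^+ r * bose (a * y ^+ r))%:E)%E.

Lemma boseint_series (r : nat) (a : R) : (0 < r)%N -> 0 < a ->
  boseint r a =
  (\sum_(0 <= k <oo) \int[mu]_(y in Rpos) (powexp r (k.+1%:R * a) y)%:E)%E.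
Proof.
move=> r0 a0; rewrite -integral_nneseries //; last 2 first.
- by move=> k; apply/measurable_EFinP; exact: measurable_powexp.
- by move=> k y; rewrite /= in_itv /= andbT => /ltW y0; rewrite lee_fin powexp_ge0.
apply: eq_integral => y; rewrite inE /= in_itv /= andbT => y0.
have yr : 0 < y ^+ r by rewrite exprn_gt0.
rewrite EFinM -bose_series ?mulr_gt0 // -nneseriesZl; last first.
  by move=> k _; rewrite lee_fin expR_ge0.
by apply: eq_eseriesr => k _; rewrite -EFinM /powexp mulrA.
Qed.

(** Since r >= 2, y^r controls y^2 for y >= 1, and a constant does for y <= 1. This supplies one
    integrable majorant for all Riemann sums. *)
Lemma inv1D_le_sqr (alpha x y : R) (r : nat) : (2 <= r)%N ->
  0 < alpha -> 0 <= y -> alpha * y ^+ r <= x ->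
  (1 + x)^-1 <= 2 / Num.min 1 alpha * (1 + y ^+ 2)^-1.
Proof.
move=> r2 a0 y0 xy; set m := Num.min 1 alpha.
have m0 : 0 < m by rewrite lt_min a0 ltr01.
have m1 : m <= 1 by rewrite ge_min lexx.
have ma : m <= alpha by rewrite ge_min lexx orbT.
have y2 : 0 <= y ^+ 2 by rewrite sqr_ge0.
have yr : 0 <= y ^+ r by rewrite exprn_ge0.
have my : m * y ^+ r <= x by apply: le_trans xy; rewrite ler_wpM2r.
have x0 : 0 <= x by apply: le_trans my; rewrite mulr_ge0 // ltW.
have h : m * (1 + y ^+ 2) <= 2 * (1 + x).
  have [y1|/ltW y1] := leP 1 y.
    have : y ^+ 2 <= y ^+ r by rewrite ler_weXn2l.
    nra.
  have : y ^+ 2 <= 1 by rewrite exprn_ile1.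
  nra.
have x1 : 0 < 1 + x by lra.
have y1 : 0 < 1 + y ^+ 2 by lra.
rewrite -[leLHS]mul1r ler_pdivrMr // mulrAC ler_pdivlMr // mul1r.
rewrite -(ler_pM2l m0); apply: le_trans h _.
by rewrite le_eqVlt; apply/orP; left; apply/eqP; field; rewrite gt_eqF.
Qed.

Lemma mulr_bose_le_sqr (alpha x y : R) (r : nat) : (2 <= r)%N ->
  0 < alpha -> 0 <= y -> 0 < x -> alpha * y ^+ r <= x ->
  x * bose x <= 12 / Num.min 1 alpha * (1 + y ^+ 2)^-1.
Proof.
move=> r2 a0 y0 x0 xy; apply: le_trans (mulr_bose_le x0) _.
apply: (@le_trans _ _ (6 * (1 + x)^-1)).
  rewrite ler_pM2l // lef_pV2 ?posrE ?exprn_gt0 //; try lra.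
  by rewrite expr2 ler_peMl; lra.
have -> : 12 / Num.min 1 alpha * (1 + y ^+ 2)^-1 =
  6 * (2 / Num.min 1 alpha * (1 + y ^+ 2)^-1) by ring.
by rewrite ler_pM2l //; exact: inv1D_le_sqr xy.
Qed.

Lemma boseint_fin (r : nat) (a : R) : (2 <= r)%N -> 0 < a ->
  (boseint r a < +oo)%E.
Proof.
move=> r2 a0; pose C := a^-1 * (12 / Num.min 1 a).
have iC := @integrable_inv1Dsqr R C.
have iC' : mu.-integrable Rpos (fun y => (C * (1 + y ^+ 2)^-1)%:E).
  apply: integrableS iC => // y /=; rewrite !in_itv /= !andbT; exact: ltW.
have C0 : 0 <= C.
  by rewrite !mulr_ge0 ?invr_ge0 ?le_min ?ler01 ?(ltW a0).
apply: le_lt_trans (_ : \int[mu]_(y in Rpos) (C * (1 + y ^+ 2)^-1)%:E < +oo)%E; last first.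
  by rewrite ltey_eq integrable_fin_num.
apply: ge0_le_integral => //.
- move=> y; rewrite /= in_itv /= andbT => y0.
  by rewrite lee_fin mulr_ge0 ?exprn_ge0 ?(ltW y0) // ltW // bose_gt0 // mulr_gt0 // exprn_gt0.
- apply/measurable_EFinP; apply: measurable_funM; first exact: measurable_funX.
  apply: measurable_bose_comp => //.
    by apply: measurable_funM => //; exact: measurable_funX.
  by move=> y; rewrite /= in_itv /= andbT => y0; rewrite mulr_ge0 ?exprn_ge0 ?ltW.
- exact: (measurable_int mu).
- move=> y; rewrite /= in_itv /= andbT => y0; rewrite lee_fin /C -mulrA ler_pdivlMl //.
  rewrite mulrA; apply: (mulr_bose_le_sqr r2 a0) => //; first exact: ltW.
  by rewrite mulr_gt0 // exprn_gt0.
Qed.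

(** [expR (- x) <= bose x], so finiteness is inherited from the Bose integral. *)
Lemma gammaint_fin (r : nat) : (2 <= r)%N -> gammaint r%:R^-1 \is a fin_num.
Proof.
move=> r2; have r0 : (0 < r)%N by exact: ltnW.
rewrite ge0_fin_numE; last by rewrite ltW // gammaint_gt0 // invr_gt0 ltr0n.
rewrite (@gammaint_subst r 1 r0 ltr01) powR1 mulr1.
apply: lte_mul_pinfty; rewrite ?lee_fin //.
apply: le_lt_trans (@boseint_fin r 1 r2 ltr01); apply: ge0_le_integral => //.
- by move=> y; rewrite /= in_itv /= andbT => /ltW y0; rewrite lee_fin powexp_ge0.
- by apply/measurable_EFinP; exact: measurable_powexp.
- apply/measurable_EFinP; apply: measurable_funM; first exact: measurable_funX.
  apply: measurable_bose_comp => //.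
    by apply: measurable_funM => //; exact: measurable_funX.
  by move=> y; rewrite /= in_itv /= andbT => y0; rewrite mulr_ge0 ?exprn_ge0 ?ltW.
- move=> y; rewrite /= in_itv /= andbT => y0; rewrite lee_fin /powexp.
  have x0 : 0 < 1 * y ^+ r by rewrite mul1r exprn_gt0.
  rewrite ler_pM2l ?exprn_gt0 // boseE // -[leLHS]mulr1 ler_pM2l ?expR_gt0 //.
  rewrite invf_ge1; last by rewrite subr_gt0 expR_lt1 oppr_lt0.
  by rewrite gerBl expR_ge0.
Qed.

(** Termwise integration of the geometric series of [bose]: the k-th term is a Gamma integral with
    parameter (k+1) a and contributes the k-th term of the zeta series. *)
Lemma boseint_scale (r : nat) (a : R) : (2 <= r)%N -> 0 < a ->
  ((r%:R * a `^ (1 + r%:R^-1))%:E * boseint r a =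
   gammaint r%:R^-1 *
   \sum_(0 <= k <oo) (k.+1%:R `^ (- (1 + r%:R^-1)))%:E)%E.
Proof.
move=> r2 a0; have r0 : (0 < r)%N by exact: ltnW.
set p : R := r%:R^-1; rewrite boseint_series // -nneseriesZl; last first.
  move=> k _; apply: integral_ge0 => y; rewrite /= in_itv /= andbT => /ltW y0.
  by rewrite lee_fin powexp_ge0.
rewrite -(fineK (gammaint_fin r2)).
rewrite -nneseriesZl; last by move=> k _; rewrite lee_fin powR_ge0.
apply: eq_eseriesr => k _; rewrite (fineK (gammaint_fin r2)).
rewrite (@gammaint_subst r (k.+1%:R * a)) ?mulr_gt0 //.
rewrite muleAC -EFinM; congr (_%:E * _)%E.
rewrite powRM ?(ltW a0) // powRN -/p; field.
by rewrite gt_eqF // powR_gt0.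
Qed.

End bose_integral.

(** * The constant [c] *)

Section constant.
Context {R : realType} (r : nat) (hr : (2 <= r)%N).
Local Notation mu := (@lebesgue_measure R).

Let r0 : (0 < r)%N. Proof. exact: ltnW. Qed.
Let rR : 0 < r%:R :> R. Proof. by rewrite ltr0n. Qed.
Let p : R := r%:R^-1.

Lemma fine_gammaint : fine (gammaint p) = Gamma (1 + p).
Proof.
rewrite /Gamma /Rintegral /gammaint; congr fine; apply: eq_integral => u _.
by rewrite [1 + p]addrC addrK.
Qed.

Lemma Gamma_gt0 : 0 < Gamma (1 + p).
Proof.
by rewrite -fine_gammaint fine_gt0 // gammaint_gt0 ?invr_gt0 //= -ge0_fin_numE
  ?gammaint_fin // ltW // gammaint_gt0 // invr_gt0.
Qed.

Lemma nneseries_zeta :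
  (\sum_(0 <= k <oo) (k.+1%:R `^ (- (1 + p)))%:E = (zeta (1 + p))%:E)%E.
Proof.
set u := fun k : nat => k.+1%:R `^ (- (1 + p)).
have u0 k : 0 <= u k by exact: powR_ge0.
set Z := (\sum_(0 <= k <oo) (u k)%:E)%E.
(* Convergence of the zeta series is read off at a = 1: its product with the positive number Gamma
   is a finite Bose integral. *)
have Zfin : Z \is a fin_num.
  have := @boseint_scale R r 1 hr ltr01; rewrite -/p -/u -/Z powR1 mulr1.
  have B0 : (0 <= boseint r (1 : R))%E.
    apply: integral_ge0 => y; rewrite /= in_itv /= andbT => y0.
    by rewrite lee_fin mulr_ge0 ?exprn_ge0 ?(ltW y0) // ltW // bose_gt0 // mul1r exprn_gt0.
  have Z0 : (0 <= Z)%E by apply: nneseries_ge0 => k _ _; rewrite lee_fin.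
  have B1 : boseint r (1 : R) \is a fin_num.
    by rewrite ge0_fin_numE // boseint_fin.
  rewrite -(fineK B1) -(fineK (gammaint_fin hr)) fine_gammaint -EFinM => e.
  rewrite ge0_fin_numE // ltey; apply/eqP => Zy.
  by move: e; rewrite Zy gt0_muley // lte_fin Gamma_gt0.
have part n : series u n <= fine Z.
  rewrite -lee_fin fineK // /series /= -sumEFin.
  by apply: nneseries_lim_ge => k _ _; rewrite lee_fin.
have cu : cvgn (series u).
  apply: nondecreasing_is_cvgn; last by exists (fine Z) => _ [n _ <-].
  by apply/nondecreasing_seqP => n; rewrite seriesS lerDr.
rewrite /Z /zeta -/u -EFin_lim //; congr (limn _).
by apply/funext => n; rewrite /= /series /= sumEFin.
Qed.

Lemma zeta_gt0 : 0 < zeta (1 + p) :> R.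
Proof.
rewrite -lte_fin -nneseries_zeta.
apply: (@lt_le_trans _ _ (\sum_(0 <= k < 1) (k.+1%:R `^ (- (1 + p)))%:E)%E).
  by rewrite big_nat1 powR1 lte_fin.
by apply: nneseries_lim_ge => k _ _; rewrite lee_fin powR_ge0.
Qed.

Lemma dconst_gt0 : 0 < dconst r%:R (r`!%:R^-1) :> R.
Proof.
apply: powR_gt0; rewrite divr_gt0 ?mulr_gt0 ?Gamma_gt0 ?zeta_gt0 //.
Qed.

(** The equation that defines c, in the form that [boseint_scale] at [a = c / r!] turns into the
    value r!. *)
Lemma dconst_powR : let c : R := dconst r%:R (r`!%:R^-1) in
  r%:R * r`!%:R * (c / r`!%:R) `^ (1 + p) = Gamma (1 + p) * zeta (1 + p).
Proof.
move=> c; have f0 : 0 < (r`!%:R : R) by rewrite ltr0n fact_gt0.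
have c0 : 0 < c by exact: dconst_gt0.
have gz : 0 < zeta (1 + p) * Gamma (1 + p).
  by rewrite mulr_gt0 ?Gamma_gt0 ?zeta_gt0.
rewrite powRM ?invr_ge0 ?ltW //.
rewrite [_^-1 `^ (1 + p)]powRD; last by apply/implyP => _; rewrite invr_eq0 gt_eqF.
have -> : c `^ (1 + p) = zeta (1 + p) * Gamma (1 + p) / (r%:R * r`!%:R^-1 `^ p).
  rewrite /c /dconst -/p -powRrM.
  have -> : r%:R / (1 + r%:R) * (1 + p) = 1.
    by rewrite /p; field; rewrite gt_eqF //= gt_eqF // ltr_wpDl.
  by rewrite powRr1 // divr_ge0 ?(ltW gz) // mulr_ge0 ?(ltW rR) // powR_ge0.
rewrite powRr1 ?invr_ge0 ?ltW //; field.
by rewrite !gt_eqF // powR_gt0 // invr_gt0.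
Qed.

Lemma boseint_dconst : let c : R := dconst r%:R (r`!%:R^-1) in
  boseint r (c / r`!%:R) = (r`!%:R)%:E.
Proof.
move=> c; have f0 : 0 < (r`!%:R : R) by rewrite ltr0n fact_gt0.
have a0 : 0 < c / r`!%:R by rewrite divr_gt0 // dconst_gt0.
have K0 : 0 < r%:R * (c / r`!%:R) `^ (1 + p) by rewrite mulr_gt0 // powR_gt0.
have B0 : (0 <= boseint r (c / r`!%:R))%E.
  apply: integral_ge0 => y; rewrite /= in_itv /= andbT => y0.
  rewrite lee_fin mulr_ge0 ?exprn_ge0 ?(ltW y0) // ltW // bose_gt0 // mulr_gt0 //.
  by rewrite exprn_gt0.
have B1 : boseint r (c / r`!%:R) \is a fin_num.
  by rewrite ge0_fin_numE // boseint_fin.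
have := boseint_scale hr a0; rewrite -/p nneseries_zeta.
rewrite -(fineK B1) -(fineK (gammaint_fin hr)) fine_gammaint -!EFinM => -[].
rewrite -dconst_powR -/c => e; congr EFin.
by apply: (mulfI (lt0r_neq0 K0)); rewrite e; ring.
Qed.

End constant.

(** * Asymptotics of the weights *)

(** Rising factorial: the kernel is a polynomial in [d] of degree [q] with leading coefficient
    1/q!. *)
Lemma diffbin_prod q d : (q`! * diffbin q.+1 d = \prod_(i < q) (d.+1 + i))%N.
Proof.
rewrite /diffbin addnS /= -bin_sub ?leq_addr // addnC addnK mulnC bin_ffact.
elim: q => [|q IH]; first by rewrite big_ord0.
by rewrite big_ord_recr /= -IH !addSn ffactSS mulnC (addnC d).
Qed.

Lemma diffbin_ge q d : (d.+1 ^ q <= q`! * diffbin q.+1 d)%N.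
Proof.
rewrite diffbin_prod -[X in (_ ^ X)%N](card_ord q) -prod_nat_const.
by apply: leq_prod => i _; rewrite leq_addr.
Qed.

Lemma diffbin_gt0 q d : (0 < diffbin q.+1 d)%N.
Proof. by rewrite bin_gt0 addnS leq_addr. Qed.

Lemma diffbin_mono q d e : (d <= e)%N -> (diffbin q.+1 d <= diffbin q.+1 e)%N.
Proof.
move=> de; rewrite -(leq_pmul2l (fact_gt0 q)) !diffbin_prod.
by apply: leq_prod => i _; rewrite leq_add2r ltnS.
Qed.

(** Absorption identity; it compares the kernel of the parts with the energy of a mode. *)
Lemma diffbin_down q k :
  ((k + q.+1) * diffbin q.+1 k = q.+1 * diffbin q.+2 k)%N.
Proof.
have q0 : (0 < q`!)%N by exact: fact_gt0.
apply/eqP; rewrite -(eqn_pmul2l q0); apply/eqP.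
rewrite mulnCA diffbin_prod mulnA [(q`! * _)%N]mulnC -factS diffbin_prod.
by rewrite [RHS]big_ord_recr /= mulnC addSn addnS.
Qed.

Section asymptotics.
Context {R : realType}.

Lemma cvg_diffbin q (d : nat -> nat) (b : nat -> R) (z : R) :
  (b n)^-1 @[n --> \oo] --> 0 ->
  (d n)%:R / b n @[n --> \oo] --> z ->
  (diffbin q.+1 (d n))%:R / b n ^+ q @[n --> \oo] --> z ^+ q / q`!%:R.
Proof.
move=> b0 dz; have f0 : (q`!%:R : R) != 0 by rewrite pnatr_eq0 -lt0n fact_gt0.
have -> : (fun n => (diffbin q.+1 (d n))%:R / b n ^+ q) =
    (fun n => (\prod_(i < q) ((d n)%:R / b n + i.+1%:R / b n)) / q`!%:R).
  apply/funext => n; apply: (mulIf f0); rewrite [RHS]divfK // mulrAC -natrM mulnC.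
  rewrite diffbin_prod natr_prod -[X in _ / _ ^+ X](card_ord q) -prodr_const.
  rewrite -prodf_div; apply: eq_bigr => i _.
  by rewrite -mulrDl -natrD addnS addSn.
apply: cvgMl; rewrite -[X in z ^+ X](card_ord q) -prodr_const.
apply: cvg_big => [|i _]; first exact: mul_continuous.
rewrite -[X in _ --> X]addr0; apply: cvgD => //.
rewrite -[X in _ --> X](mulr0 i.+1%:R); apply: cvgM => //; exact: cvg_cst.
Qed.

Lemma cvg_truncn (b : nat -> R) (y : R) : 0 <= y ->
  (\forall n \near \oo, 0 < b n) -> (b n)^-1 @[n --> \oo] --> 0 ->
  (Num.truncn (b n * y))%:R / b n @[n --> \oo] --> y.
Proof.
move=> y0 bp b0; apply: (@squeeze_cvgr _ _ _ _ (fun n => y - (b n)^-1) (fun=> y)).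
- near=> n; have bn : 0 < b n by near: n.
  have /truncn_itv/andP[h1 h2] : 0 <= b n * y by rewrite mulr_ge0 // ltW.
  rewrite ler_pdivlMr // ler_pdivrMr // mulrBl mulVf ?gt_eqF //.
  by rewrite [y * _]mulrC h1 andbT; move: h2; rewrite -natr1; lra.
- by rewrite -[X in _ --> X]subr0; apply: cvgB => //; exact: cvg_cst.
- exact: cvg_cst.
Unshelve. all: by end_near. Qed.

Lemma cvg_bose (u : nat -> R) (x : R) : 0 < x -> u n @[n --> \oo] --> x ->
  bose (u n) @[n --> \oo] --> bose x.
Proof.
move=> x0 ux; apply: cvgV; first by rewrite gt_eqF // expRB1_gt0.
apply: cvgB; last exact: cvg_cst.
by apply: continuous_cvg => //; exact: continuous_expR.
Qed.

End asymptotics.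

(** * Limits of the mean energy and of the mean parts *)

Section limits.
Context {R : realType} (r : nat) (hr : (2 <= r)%N).
Local Notation mu := (@lebesgue_measure R).
Let r0 : (0 < r)%N. Proof. exact: ltnW. Qed.

Definition scale (n : nat) : R := n%:R `^ (1 + r%:R)^-1.

Lemma scale_gt0 n : (0 < n)%N -> 0 < scale n.
Proof. by move=> n0; rewrite powR_gt0 // ltr0n. Qed.

Lemma scale_ge0 n : 0 <= scale n.
Proof. exact: powR_ge0. Qed.

Lemma scale_pow n : scale n ^+ r.+1 = n%:R.
Proof.
rewrite -powR_mulrn ?scale_ge0 // /scale -powRrM -nat1r mulVf ?powRr1 //.
Qed.

Lemma cvgy_scale : scale n @[n --> \oo] --> +oo.
Proof.
apply/cvgryPge => M; near=> n; rewrite leNgt; apply/negP => h.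
have : scale n ^+ r.+1 < (Num.max M 1) ^+ r.+1.
  by rewrite ltrXn2r ?scale_ge0 // lt_max h.
rewrite scale_pow; apply/negP; rewrite -leNgt.
by near: n; apply: nbhs_infty_ger.
Unshelve. all: by end_near. Qed.

Lemma cvg_scaleV : (scale n)^-1 @[n --> \oo] --> 0.
Proof. apply/gtr0_cvgV0; last exact: cvgy_scale.
near=> n; apply: scale_gt0; near: n; exact: nbhs_infty_gt.
Unshelve. all: by end_near. Qed.

Let c : R := dconst r%:R (r`!%:R^-1).
Let c0 : 0 < c. Proof. exact: dconst_gt0. Qed.
Let f0 : 0 < (r`!%:R : R). Proof. by rewrite ltr0n fact_gt0. Qed.

(** The inverse temperature. *)
Definition temp (n : nat) : R := c / scale n ^+ r.

Lemma temp_gt0 n : (0 < n)%N -> 0 < temp n.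
Proof. by move=> n0; rewrite divr_gt0 // exprn_gt0 // scale_gt0. Qed.

Lemma temp_ge0 n : 0 <= temp n.
Proof. by rewrite divr_ge0 ?exprn_ge0 ?scale_ge0 // ltW. Qed.

(** Valid up to the right end of the k-th cell, because the weight is at least (k+1)^r / r!; so it
    can be used at every point of the cell. *)
Lemma temp_weight_ge n k y : (0 < n)%N -> 0 <= y -> y <= k.+1%:R / scale n ->
  c / r`!%:R * y ^+ r <= temp n * (diffbin r.+1 k)%:R.
Proof.
move=> n0 y0 yk; have sn := scale_gt0 n0.
apply: (@le_trans _ _ (c / r`!%:R * (k.+1%:R / scale n) ^+ r)).
  by rewrite ler_pM2l ?divr_gt0 // lerXn2r // nnegrE divr_ge0 // ltW.
have := diffbin_ge r k; rewrite -(ler_nat R) natrM natrX => h.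
have -> : c / r`!%:R * (k.+1%:R / scale n) ^+ r =
  temp n * (k.+1%:R ^+ r / r`!%:R).
  by rewrite /temp expr_div_n; field; rewrite !gt_eqF ?exprn_gt0.
by rewrite ler_pM2l ?temp_gt0 // ler_pdivrMr // mulrC.
Qed.

Lemma cvg_weight (k : nat -> nat) (y : R) :
  (k n)%:R / scale n @[n --> \oo] --> y ->
  (diffbin r.+1 (k n))%:R / scale n ^+ r @[n --> \oo] --> y ^+ r / r`!%:R.
Proof. exact: cvg_diffbin cvg_scaleV. Qed.

Lemma cvg_bose_weight (k : nat -> nat) (y : R) : 0 < y ->
  (k n)%:R / scale n @[n --> \oo] --> y ->
  bose (temp n * (diffbin r.+1 (k n))%:R) @[n --> \oo] --> bose (c * (y ^+ r / r`!%:R)).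
Proof.
move=> y0 ky; apply: cvg_bose; first by rewrite mulr_gt0 // divr_gt0 // exprn_gt0.
under eq_fun do rewrite /temp mulrAC -mulrA.
by apply: cvgM; [exact: cvg_cst | exact: cvg_weight].
Qed.

Lemma near_truncn_lt y : 0 <= y ->
  \forall n \near \oo, (Num.truncn (scale n * y) < n)%N.
Proof.
move=> y0; near=> n.
have n0 : (0 < n)%N by near: n; exact: nbhs_infty_gt.
have sn := scale_gt0 n0.
have s1 : 1 <= scale n by near: n; move/cvgryPge : cvgy_scale; apply.
have sy : y < scale n by near: n; move/cvgryPgt : cvgy_scale; apply.
rewrite truncn_lt_nat ?mulr_ge0 ?(ltW sn) // -(scale_pow n) exprS ltr_pM2l //.
apply: lt_le_trans sy _; rewrite -[leLHS]expr1; exact: ler_weXn2l.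
Unshelve. all: by end_near. Qed.

Let cf0 : 0 < c / r`!%:R. Proof. by rewrite divr_gt0. Qed.
Let dom : R := c^-1 * (12 / Num.min 1 (c / r`!%:R)).

Let dom_ge0 : 0 <= dom.
Proof. by rewrite !mulr_ge0 ?invr_ge0 ?(ltW c0) // le_min ler01 ltW. Qed.

Lemma bose_ge0 (x : R) : 0 <= x -> 0 <= bose x.
Proof. by move=> x0; rewrite invr_ge0 subr_ge0 -expR0 ler_expR. Qed.

Lemma temp_weight_ge0 n k : 0 <= temp n * (diffbin r.+1 k)%:R.
Proof. by rewrite mulr_ge0 ?temp_ge0. Qed.

Lemma temp_weight_gt0 n k : (0 < n)%N -> 0 < temp n * (diffbin r.+1 k)%:R.
Proof. by move=> n0; rewrite mulr_gt0 ?temp_gt0 // ltr0n diffbin_gt0. Qed.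

Lemma weight_bose_le n k y : (0 < n)%N -> 0 <= y -> scale n * y < k.+1%:R ->
  (diffbin r.+1 k)%:R / scale n ^+ r * bose (temp n * (diffbin r.+1 k)%:R) <=
  dom * (1 + y ^+ 2)^-1.
Proof.
move=> n0 y0 yk; have sn := scale_gt0 n0.
set B := bose _; have -> : (diffbin r.+1 k)%:R / scale n ^+ r * B =
    c^-1 * (temp n * (diffbin r.+1 k)%:R * B).
  by rewrite /temp; field; rewrite !gt_eqF ?exprn_gt0.
have -> : dom * (1 + y ^+ 2)^-1 =
    c^-1 * (12 / Num.min 1 (c / r`!%:R) * (1 + y ^+ 2)^-1) by rewrite /dom; ring.
rewrite ler_pM2l ?invr_gt0 //.
apply: (mulr_bose_le_sqr hr cf0) => //; first exact: temp_weight_gt0.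
by apply: temp_weight_ge => //; rewrite ler_pdivlMr // mulrC ltW.
Qed.

Lemma measurable_bose_pow (D : set R) : measurable D -> D `<=` `[0, +oo[%classic ->
  measurable_fun D (fun y => bose (c * (y ^+ r / r`!%:R))).
Proof.
move=> mD D0; apply: measurable_bose_comp => //.
  by apply: measurable_funM => //; apply: measurable_funM => //; exact: measurable_funX.
move=> y /D0; rewrite /= in_itv /= andbT => y0.
by rewrite mulr_ge0 ?divr_ge0 ?exprn_ge0 ?(ltW f0) ?(ltW c0).
Qed.

Lemma cvg_truncn_scale y : 0 <= y ->
  (Num.truncn (scale n * y))%:R / scale n @[n --> \oo] --> y.
Proof.
move=> y0; apply: cvg_truncn cvg_scaleV => //.
by near=> n; apply: scale_gt0; near: n; exact: nbhs_infty_gt.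
Unshelve. all: by end_near. Qed.

(* The limit is [1] by the choice of [c]. *)
Lemma cvg_mean_weight :
  (n%:R)^-1 * (\sum_(k < n) (diffbin r.+1 k)%:R * bose (temp n * (diffbin r.+1 k)%:R))
    @[n --> \oo] --> (1 : R).
Proof.
pose g (y : R) := y ^+ r / r`!%:R * bose (c * (y ^+ r / r`!%:R)).
pose h n k : R := (diffbin r.+1 k)%:R / scale n ^+ r *
  bose (temp n * (diffbin r.+1 k)%:R).
have mg (D : set R) : measurable D -> D `<=` `[0, +oo[%classic -> measurable_fun D g.
  move=> mD D0; apply: measurable_funM; last exact: measurable_bose_pow.
  by apply: measurable_funM => //; exact: measurable_funX.
have [|||||||_] := @cvg_riemann_sum R scale h g (fun y => dom * (1 + y ^+ 2)^-1) 0.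
- exact: scale_gt0.
- move=> n k; rewrite mulr_ge0 ?divr_ge0 ?exprn_ge0 ?scale_ge0 //.
  by rewrite bose_ge0 // temp_weight_ge0.
- by move=> n k y n0 y0 /andP[_ yk]; exact: weight_bose_le.
- by move=> y; rewrite mulr_ge0 // invr_ge0 addr_ge0 // sqr_ge0.
- exact: integrable_inv1Dsqr.
- by apply: mg => //; exact: measurable_itv.
- move=> y y0 _; have cy := cvg_truncn_scale (ltW y0).
  have : h n (Num.truncn (scale n * y)) @[n --> \oo] --> g y.
    by apply: cvgM; [exact: cvg_weight | exact: cvg_bose_weight].
  apply: cvg_trans; apply: near_eq_cvg.
  by near=> n; rewrite ifT //; near: n; apply: near_truncn_lt; exact: ltW.
have -> : \int[mu]_(y in `[0%R, +oo[) g y = 1.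
  rewrite /Rintegral -integral_itv_obnd_cbnd; last first.
    apply/measurable_EFinP; apply: mg; first exact: measurable_itv.
    by move=> y; rewrite /= !in_itv /= !andbT => /ltW.
  have -> : (\int[mu]_(y in `]0%R, +oo[) (g y)%:E =
      (r`!%:R^-1)%:E * boseint r (c / r`!%:R))%E.
    rewrite -ge0_integralZl //=; last 2 first.
    - apply/measurable_EFinP; apply: measurable_funM; first exact: measurable_funX.
      apply: eq_measurable_fun (measurable_bose_pow _ _) => [y _||//].
      + by congr bose; ring.
      + exact: measurable_itv.
      + by move=> y; rewrite /= !in_itv /= !andbT => /ltW.
    - move=> y; rewrite in_itv /= andbT => /ltW y0; rewrite lee_fin.
      by rewrite mulr_ge0 ?exprn_ge0 // bose_ge0 // mulr_ge0 ?exprn_ge0 // ltW.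
    apply: eq_integral => y _; rewrite -EFinM /g; congr EFin.
    have -> : c * (y ^+ r / r`!%:R) = c / r`!%:R * y ^+ r by ring.
    by ring.
  by rewrite boseint_dconst //= mulVf ?gt_eqF.
apply: cvg_trans; apply: near_eq_cvg; near=> n.
have n0 : (0 < n)%N by near: n; exact: nbhs_infty_gt.
rewrite -(scale_pow n) exprS invfM -mulrA; congr (_ * _).
rewrite mulr_sumr; apply: eq_bigr => k _; rewrite /h; ring.
Unshelve. all: by end_near.
Qed.

(** Bounds the quadratic cost of a tilt. With b = [scale n], each term is dominated by a telescoping
    one, since (b + k) (b + k + 1) <= 2 (b^2 + (k+1)^2). *)
Lemma sum_inv_weight_le : exists2 C : R, 0 < C & forall n, (0 < n)%N ->
  \sum_(k < n) (1 + temp n * (diffbin r.+1 k)%:R)^-1 <= C * scale n.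
Proof.
pose K : R := 2 / Num.min 1 (c / r`!%:R).
have K0 : 0 < K by rewrite divr_gt0 // lt_min ltr01 cf0.
exists (2 * K) => [|n n0]; first by rewrite mulr_gt0.
have b0 := scale_gt0 n0; set b := scale n in b0 *.
apply: (@le_trans _ _ (\sum_(k < n) K * (2 * b ^+ 2 * ((b + k%:R)^-1 - (b + k.+1%:R)^-1)))).
  apply: ler_sum => k _; have yk : 0 <= k.+1%:R / b by rewrite divr_ge0 // ltW.
  apply: le_trans (inv1D_le_sqr hr cf0 yk (temp_weight_ge n0 yk (lexx _))) _.
  rewrite ler_pM2l // -/b; have k0 : 0 <= (k : nat)%:R :> R by [].
  have k1 : (k.+1%:R : R) = k%:R + 1 by rewrite natr1.
  have p0 : 0 < b + k%:R by lra.
  have p1 : 0 < b + k.+1%:R by lra.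
  have p2 : 0 < b ^+ 2 + k.+1%:R ^+ 2 by rewrite ltr_pwDl ?sqr_ge0 // exprn_gt0.
  have -> : (1 + (k.+1%:R / b) ^+ 2)^-1 = b ^+ 2 / (b ^+ 2 + k.+1%:R ^+ 2).
    field; rewrite !gt_eqF //= ?addr_gt0 ?exprn_gt0 //.
  have -> : 2 * b ^+ 2 * ((b + k%:R)^-1 - (b + k.+1%:R)^-1) =
      b ^+ 2 * (2 / ((b + k%:R) * (b + k.+1%:R))).
    by rewrite k1; field; apply/andP; split; apply: lt0r_neq0; lra.
  rewrite ler_pM2l ?exprn_gt0 // -[leLHS]mul1r ler_pdivrMr // mulrAC.
  rewrite ler_pdivlMr ?mulr_gt0 // mul1r k1.
  have := sqr_ge0 (b - (k%:R + 1)); nra.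
rewrite -mulr_sumr -mulr_sumr.
have T m : \sum_(k < m) ((b + k%:R)^-1 - (b + k.+1%:R)^-1) = b^-1 - (b + m%:R)^-1.
  elim: m => [|m IH]; first by rewrite big_ord0 addr0 subrr.
  by rewrite big_ord_recr /= IH; ring.
rewrite T [2 * K]mulrC -[leRHS]mulrA ler_pM2l // -mulrA ler_pM2l // expr2 -mulrA.
rewrite ler_piMr ?(ltW b0) // mulrBr mulfV ?gt_eqF // gerBl mulr_ge0 ?(ltW b0) //.
by rewrite invr_ge0 addr_ge0 // ltW.
Qed.

Definition limit_shape (t y : R) : R := (y - t) ^+ r.-1 / r.-1`!%:R
  * (expR (- (c * y ^+ r / r`!%:R)) / (1 - expR (- (c * y ^+ r / r`!%:R)))).

(** Zero-based index of the part that the diagram reads at abscissa [t]. *)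
Definition first_index (t : R) (n : nat) : nat := `|Num.ceil (scale n * t)|.-1.

Lemma first_index_itv t n : 0 < t -> (0 < n)%N ->
  (first_index t n)%:R < scale n * t <= (first_index t n).+1%:R.
Proof.
move=> t0 n0; have x0 : 0 < scale n * t by rewrite mulr_gt0 // scale_gt0.
have := ceil_itv (scale n * t).
have : 0 < Num.ceil (scale n * t) by rewrite ceil_gt0.
rewrite /first_index; case: (Num.ceil _) => // -[//|m] _ /=.
by have -> : (m.+1%:Z - 1)%R = m%:Z by lia.
Qed.

Lemma cvg_first_index t : 0 < t ->
  (first_index t n)%:R / scale n @[n --> \oo] --> t.
Proof.
move=> t0; apply: (@squeeze_cvgr _ _ _ _ (fun n => t - (scale n)^-1) (fun=> t)).
- near=> n; have n0 : (0 < n)%N by near: n; exact: nbhs_infty_gt.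
  have bn := scale_gt0 n0; have /andP[h1 h2] := first_index_itv t0 n0.
  rewrite ler_pdivlMr // ler_pdivrMr // mulrBl mulVf ?gt_eqF //.
  by rewrite [t * _]mulrC (ltW h1) andbT; move: h2; rewrite -natr1; lra.
- rewrite -[X in _ --> X]subr0; apply: cvgB; first exact: cvg_cst.
  exact: cvg_scaleV.
- exact: cvg_cst.
Unshelve. all: by end_near. Qed.

(** By the absorption identity the kernel is [r / (k + r)] times the energy, and
    [k + r >= scale n * t] for the modes that reach this part. Both the domination of the mean part
    and the smallness of the tilt rest on it. *)
Lemma diffbin_le_weight n k t : 0 < t -> (0 < n)%N -> (first_index t n <= k)%N ->
  (diffbin r (k - first_index t n))%:R <=
  r%:R / (scale n * t) * (diffbin r.+1 k)%:R :> R.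
Proof.
move=> t0 n0 jk; have /andP[_ h2] := first_index_itv t0 n0.
have st : 0 < scale n * t by rewrite mulr_gt0 // scale_gt0.
have D : (diffbin r (k - first_index t n) <= diffbin r k)%N.
  by rewrite -(prednK r0); apply: diffbin_mono; rewrite leq_subr.
apply: (@le_trans _ _ (diffbin r k)%:R); first by rewrite ler_nat.
have := diffbin_down r.-1 k; rewrite prednK // => /(congr1 (fun x => x%:R : R)).
rewrite !natrM => e.
rewrite mulrAC ler_pdivlMr // -e mulrC ler_wpM2r //.
apply: le_trans h2 _; rewrite ler_nat -addn1; exact: leq_add.
Qed.

Lemma cvg_mean_part (t : R) : 0 < t ->
  (scale n ^+ r)^-1 * (\sum_(k < n | (first_index t n <= k)%N)
     (diffbin r (k - first_index t n))%:R * bose (temp n * (diffbin r.+1 k)%:R))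
    @[n --> \oo] --> \int[mu]_(y in `[t, +oo[) limit_shape t y.
Proof.
move=> t0; pose g0 (y : R) := (y - t) ^+ r.-1 / r.-1`!%:R * bose (c * (y ^+ r / r`!%:R)).
pose T : set R := `[t, +oo[%classic.
pose g := g0 \_ T.
pose h n k : R := if (first_index t n <= k)%N then
  (diffbin r (k - first_index t n))%:R / scale n ^+ r.-1 *
  bose (temp n * (diffbin r.+1 k)%:R) else 0.
have TP : T `<=` (`[(0:R), +oo[%classic : set R).
  by move=> y; rewrite /T /= !in_itv /= !andbT; apply: le_trans; exact: ltW.
have mT : measurable T by exact: measurable_itv.
have dge (y : R) : 0 <= r%:R / t * dom * (1 + y ^+ 2)^-1.
  apply: mulr_ge0; first by rewrite mulr_ge0 // divr_ge0 // ltW.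
  by rewrite invr_ge0 addr_ge0 // sqr_ge0.
have [|||||||_] := @cvg_riemann_sum R scale h g (fun y => r%:R / t * dom * (1 + y ^+ 2)^-1) t.
- exact: scale_gt0.
- move=> n k; rewrite /h; case: ifP => // _.
  by rewrite mulr_ge0 ?divr_ge0 ?exprn_ge0 ?scale_ge0 // bose_ge0 // temp_weight_ge0.
- move=> n k y n0 y0 /andP[_ yk]; rewrite /h; case: ifPn => jk; last first.
    exact: dge.
  have sn := scale_gt0 n0.
  have W := weight_bose_le n0 y0 yk; have D := diffbin_le_weight t0 n0 jk.
  apply: (@le_trans _ _ (r%:R / t * ((diffbin r.+1 k)%:R / scale n ^+ r *
      bose (temp n * (diffbin r.+1 k)%:R)))).
    rewrite [leRHS]mulrA; apply: ler_wpM2r; first by rewrite bose_ge0 // temp_weight_ge0.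
    apply: (@le_trans _ _ (r%:R / (scale n * t) * (diffbin r.+1 k)%:R / scale n ^+ r.-1)).
      by rewrite ler_pM2r // invr_gt0 exprn_gt0.
    rewrite -[in scale n ^+ r](prednK r0) exprS le_eqVlt; apply/orP; left; apply/eqP.
    by field; rewrite !gt_eqF // exprn_gt0.
  by rewrite -[leRHS]mulrA ler_wpM2l // divr_ge0 // ltW.
- exact: dge.
- exact: integrable_inv1Dsqr.
- apply: measurable_funTS; apply/(measurable_restrictT _ mT).
  apply: measurable_funM; last exact: measurable_bose_pow.
  by apply: measurable_funM => //; apply: measurable_funX; exact: measurable_funB.
- move=> y y0 yt; have cy := cvg_truncn_scale (ltW y0).
  have ct := cvg_first_index t0.
  have hg : h n (Num.truncn (scale n * y)) @[n --> \oo] --> g y.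
    (* The index constraint eventually holds for y > t and eventually fails for y < t; the point y =
       t is the exceptional one. *)
    have [ty|yt'] := ltP t y.
      have -> : g y = g0 y by rewrite /g patchE mem_set // /T /= in_itv /= andbT ltW.
      have jk : \forall n \near \oo, (first_index t n <= Num.truncn (scale n * y))%N.
        near=> n; have n0 : (0 < n)%N by near: n; exact: nbhs_infty_gt.
        have sn := scale_gt0 n0; have /andP[h1 _] := first_index_itv t0 n0.
        rewrite -ltnS -(ltr_nat R); apply: lt_trans h1 _.
        apply: (@lt_trans _ _ (scale n * y)); first by rewrite ltr_pM2l.
        exact: truncnS_gt.
      apply: cvg_trans (_ : (diffbin r (Num.truncn (scale n * y) - first_index t n))%:R /
          scale n ^+ r.-1 * bose (temp n * (diffbin r.+1 (Num.truncn (scale n * y)))%:R)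
          @[n --> \oo] --> g0 y).
        by apply: near_eq_cvg; near=> n; rewrite /h ifT //; near: n.
      apply: cvgM; last exact: cvg_bose_weight.
      rewrite -{1}(prednK r0); apply: cvg_diffbin; first exact: cvg_scaleV.
      apply: cvg_trans (cvgB cy ct); apply: near_eq_cvg; near=> n.
      by rewrite /= natrB ?mulrBl //; near: n.
    have -> : g y = 0.
      rewrite /g patchE memNset // /T /= in_itv /= andbT; apply/negP; rewrite -ltNge.
      by rewrite lt_neqAle yt.
    have d0 : 0 < t - y by rewrite subr_gt0 lt_neqAle yt.
    apply: cvg_near_cst; near=> n.
    have n0 : (0 < n)%N by near: n; exact: nbhs_infty_gt.
    have sn := scale_gt0 n0; have /andP[_ h2] := first_index_itv t0 n0.
    rewrite /h ifF //; apply/negbTE; rewrite -ltnNge -(ltr_nat R).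
    have /truncn_itv/andP[h3 _] : 0 <= scale n * y by rewrite mulr_ge0 // ltW.
    apply: le_lt_trans h3 _.
    (* The gap between y and t then exceeds one cell, which absorbs the rounding in
       [first_index]. *)
    have h4 : (t - y)^-1 < scale n by near: n; move/cvgryPgt : cvgy_scale; apply.
    have : 1 < scale n * (t - y) by rewrite -ltr_pdivrMr // mul1r.
    by move: h2; rewrite -natr1; lra.
  apply: cvg_trans hg; apply: near_eq_cvg.
  by near=> n; rewrite ifT //; near: n; apply: near_truncn_lt; exact: ltW.
have -> : \int[mu]_(y in `[0%R, +oo[) g y = \int[mu]_(y in `[t, +oo[) limit_shape t y.
  rewrite /g -Rintegral_mkcondr (setIidr TP); apply: eq_Rintegral => y.
  rewrite inE /T /= in_itv /= andbT => ty; rewrite /g0 /limit_shape boseE ?mulrA //.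
  by rewrite -mulrA mulr_gt0 // divr_gt0 // exprn_gt0 // (lt_le_trans t0).
apply: cvg_trans; apply: near_eq_cvg; near=> n.
have n0 : (0 < n)%N by near: n; exact: nbhs_infty_gt.
rewrite -{1}(prednK r0) exprS invfM -mulrA; congr (_ * _).
rewrite [in RHS]big_mkcond mulr_sumr; apply: eq_bigr => k _; rewrite /h.
by case: ifP => _; rewrite ?mulr0 //; ring.
Unshelve. all: by end_near.
Qed.

End limits.

(** * Counting partitions *)

Section counting.
Context (r n : nat) (r0 : (0 < r)%N).

Definition partset : set intpart := nonneg_differences r `&` of_weight n.

Definition cardpart (E : set intpart) : nat := #|` fset_set (partset `&` E)|.

Lemma finite_partset E : finite_set (partset `&` E).
Proof.
apply: sub_finite_set (finite_of_weight n).
by move=> l [[]].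
Qed.

Lemma cardpart_setT : #|` fset_set partset| = cardpart setT.
Proof. by rewrite /cardpart setIT. Qed.

Lemma mem_partset E l : (l \in fset_set (partset `&` E)) = (l \in partset `&` E).
Proof. by rewrite in_fset_set //; exact: finite_partset. Qed.

Lemma partset_size l : partset l -> (size l <= n)%N.
Proof. by move=> [_ <-]; exact: size_le_weight. Qed.

Lemma cardpart_mono (E F : set intpart) : partset `&` E `<=` F ->
  (cardpart E <= cardpart F)%N.
Proof.
move=> EF; apply: fsubset_leq_card; apply/fsubsetP => l.
by rewrite !mem_partset !inE => -[Xl El]; split => //; exact: EF.
Qed.

Lemma cardpart_setU E F : (cardpart (E `|` F) <= cardpart E + cardpart F)%N.
Proof.
rewrite /cardpart setIUr fset_setU; [|exact: finite_partset..].
by rewrite cardfsU leq_subr.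
Qed.

Lemma cardpart_cover (I : eqType) (s : seq I) (E : set intpart) (B : I -> set intpart) :
  (forall l, partset l -> E l \/ exists2 i, i \in s & B i l) ->
  (cardpart setT <= cardpart E + \sum_(i <- s) cardpart (B i))%N.
Proof.
elim: s E => [|i s IH] E cov.
  rewrite big_nil addn0; apply: cardpart_mono => l [Xl _].
  by have [//|[]] := cov l Xl.
rewrite big_cons addnA.
apply: leq_trans (IH (E `|` B i) _) _.
  move=> l Xl; have [El|[j]] := cov l Xl; first by left; left.
  rewrite inE => /predU1P[->|js] Bl; first by left; right.
  by right; exists j.
by rewrite leq_add2r cardpart_setU.
Qed.

Lemma mult_le l k : partset l -> (k < n)%N -> (mult r l k <= n)%N.
Proof.
move=> Xl kn; have [lA wl] := Xl; rewrite -[leqRHS]wl.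
rewrite (weight_mult lA (partset_size Xl)) (bigD1 (Ordinal kn)) //=.
apply: leq_trans (leq_addr _ _); rewrite leq_pmull //.
by rewrite /diffbin bin_gt0 addnS leq_addr.
Qed.

(** Putting the deficit into mode 0 may merge different multiplicities; recording the energy, one of
    n + 1 values, restores injectivity. *)
Lemma cardpart_ge M (P : pred {ffun 'I_n -> 'I_M.+1}) : (0 < n)%N ->
  (forall m, P m -> \sum_(k < n) diffbin r.+1 k * m k <= n)%N ->
  (#|P| <= n.+1 * cardpart setT)%N.
Proof.
move=> n0 Pn.
pose W (m : {ffun 'I_n -> 'I_M.+1}) := (\sum_(k < n) diffbin r.+1 k * m k)%N.
pose val_of (m : {ffun 'I_n -> 'I_M.+1}) (k : nat) :=
  (oapp (fun i : 'I_n => nat_of_ord (m i)) 0 (insub k))%N.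
have val_ofE m (k : 'I_n) : val_of m k = m k by rewrite /val_of valK.
pose ext m k := (val_of m k + (k == 0) * (n - W m))%N.
(* [P m] sits inside the existential so that [choice] yields a total function. *)
have H m : exists l : intpart, P m -> partset l /\ forall k, (k < n)%N -> mult r l k = ext m k.
  have [l [lA wl ml]] := exists_intpart_mult n (ext m) r0.
  exists l => Pm; split => //; split => //.
  rewrite /of_weight /= wl /ext.
  rewrite (eq_bigr (fun k : 'I_n => diffbin r.+1 k * m k + (k == Ordinal n0) * (n - W m)))%N.
    rewrite big_split /= -/(W m) [X in (_ + X)%N](bigD1 (Ordinal n0)) //= ?eqxx mul1n big1 ?addn0.
      by rewrite subnKC // Pn.
    by move=> i /negPf ->.
  move=> k _; rewrite val_ofE mulnDr -val_eqE /=; case: eqP => [->|_]; last by rewrite !mul0n muln0.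
  by rewrite diffbinn0 !mul1n.
have [f fP] := choice H.
pose F m := (f m, W m).
have injF : {in enum P &, injective F}.
  move=> m1 m2; rewrite !mem_enum => P1 P2 [e1 e2].
  have [_ E1] := fP _ P1; have [_ E2] := fP _ P2.
  apply/ffunP => k; apply: val_inj => /=.
  have := E1 k (ltn_ord k); rewrite e1 E2 // /ext !val_ofE e2 => /addIn ->//.
rewrite cardE -(size_map F) mulnC -(size_iota 0 n.+1) -(size_allpairs pair).
apply: uniq_leq_size; first by rewrite map_inj_in_uniq ?enum_uniq.
move=> x /mapP[m]; rewrite mem_enum => Pm ->.
apply/allpairsP; exists (f m, W m); split => //.
  have [Xf _] := fP _ Pm.
  by rewrite mem_partset inE; split.
by rewrite mem_iota [(f m, W m).2]/= add0n ltnS Pn.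
Qed.

(** All partitions of n have the same Boltzmann weight [expR (- (s * n))], so counting them amounts
    to a Boltzmann sum; their multiplicities fit into the box with cap n. *)
Lemma cardpart_chernoff (R : realType) (s A : R) (d : nat -> R) (E : set intpart) :
  (forall k, (k < n)%N -> 0 < s * (diffbin r.+1 k)%:R - d k) ->
  (forall l, partset l -> E l -> A <= \sum_(k < n) d k * (mult r l k)%:R) ->
  (cardpart E)%:R <= expR (s * n%:R - A +
    \sum_(k < n) logpart (s * (diffbin r.+1 k)%:R - d k)).
Proof.
move=> sd AE.
pose F (l : intpart) : {ffun 'I_n -> 'I_n.+1} := [ffun k : 'I_n => inord (mult r l k)].
pose S := fset_set (partset `&` E).
have SP l : l \in S -> partset l /\ E l by rewrite mem_partset inE.
have FE l (k : 'I_n) : partset l -> F l k = mult r l k :> nat.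
  by move=> Xl; rewrite ffunE inordK // ltnS mult_le.
have injF : {in (S : seq intpart) &, injective F}.
  move=> l l' /SP[Xl _] /SP[Xl' _] e.
  have [lA _] := Xl; have [lA' _] := Xl'.
  apply: (mult_inj lA lA' (partset_size Xl) (partset_size Xl')) => k kn.
  have := congr1 (fun f : {ffun 'I_n -> 'I_n.+1} => f (Ordinal kn) : nat) e.
  by rewrite !FE.
pose P : pred {ffun 'I_n -> 'I_n.+1} := mem (map F S).
have cP : cardpart E = #|P|.
  have /card_uniqP -> : uniq (map F S) by rewrite map_inj_in_uniq ?fset_uniq.
  by rewrite size_map.
have linE y l : partset l -> lin y (F l) = \sum_(k < n) y k * (mult r l k)%:R :> R.
  by move=> Xl; apply: eq_bigr => k _; rewrite FE.
have C := @tilted_sum_le _ n n (fun k => s * (diffbin r.+1 k)%:R) d A P sd.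
have {}C : \sum_(m | P m) expR (- lin (fun k => s * (diffbin r.+1 k)%:R) m) <=
    expR (- A + \sum_(k < n) logpart (s * (diffbin r.+1 k)%:R - d k)).
  apply: C => m /mapP[l lS ->]; have [Xl El] := SP _ lS.
  by rewrite linE //; exact: AE.
have e : \sum_(m | P m) expR (- lin (fun k => s * (diffbin r.+1 k)%:R) m) =
    (cardpart E)%:R * expR (- (s * n%:R)).
  rewrite cP mulr_natl -sumr_const; apply: eq_bigr => m /mapP[l lS ->].
  have [Xl _] := SP _ lS; rewrite linE //; congr (expR (- _)).
  have [lA wl] := Xl; rewrite -[in RHS]wl (weight_mult lA (partset_size Xl)).
  rewrite natr_sum mulr_sumr; apply: eq_bigr => k _.
  by rewrite natrM mulrA.
rewrite e expRN ler_pdivrMr ?expR_gt0 // -expRD in C.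
by apply: le_trans C _; rewrite ler_expR; lra.
Qed.

Lemma cardpart_gt0 : (0 < n)%N -> (0 < cardpart setT)%N.
Proof.
move=> n0; have [l [lA wl _]] := exists_intpart_mult n (fun k => (k == 0) * n)%N r0.
rewrite /cardpart cardfs_gt0; apply/fset0Pn; exists l; rewrite mem_partset inE; split => //.
split => //; rewrite /of_weight /= wl (bigD1 (Ordinal n0)) //= diffbinn0 !mul1n.
rewrite big1 ?addn0 // => k; rewrite -val_eqE /= => /negPf ->.
by rewrite mul0n muln0.
Qed.

End counting.

(** * Concentration *)

Section concentration.
Context {R : realType} (r : nat) (hr : (2 <= r)%N).
Let r0 : (0 < r)%N. Proof. exact: ltnW. Qed.
Let c : R := dconst r%:R (r`!%:R^-1).
Let c0 : 0 < c. Proof. exact: dconst_gt0. Qed.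
Local Notation b := (@scale R r).
Local Notation temp := (@temp R r).

Lemma temp_mul n : (0 < n)%N -> temp n * n%:R = c * b n.
Proof.
move=> n0; have bn := @scale_gt0 R r n n0.
by rewrite -(@scale_pow R r n) exprS /temp -/c; field; rewrite gt_eqF // exprn_gt0.
Qed.

Lemma near_scale_gt M : \forall n \near \oo, M < b n.
Proof. by move/cvgryPgt : (@cvgy_scale R r); apply. Qed.

Lemma near_linear_le_exp (e : R) : 0 < e ->
  \forall n \near \oo, 2 * n.+1%:R <= expR (e * b n).
Proof.
move=> e0; near=> n; have n0 : (0 < n)%N by near: n; exact: nbhs_infty_gt.
have bn := @scale_gt0 R r n n0.
(* The exponential term of degree r + 2 is one degree above [b n ^+ r.+1 = n], hence of order n
   times [b n]. *)
set F : R := r.+2`!%:R; have F0 : 0 < F by rewrite ltr0n fact_gt0.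
have h : 4 * F / e ^+ r.+2 < b n by near: n; exact: near_scale_gt.
apply: (@le_trans _ _ (1 + (e * b n) ^+ r.+2 / F)); last first.
  by apply: expR_ge1Dxn; rewrite mulr_ge0 // ltW.
have n1 : 1 <= n%:R :> R by rewrite ler1n.
apply: (@le_trans _ _ (4 * n%:R)); first by rewrite -natr1; lra.
rewrite exprMn [b n ^+ _]exprS (@scale_pow R r n) ltW // ltr_pwDl // ler_pdivlMr //.
rewrite ltr_pdivrMr ?exprn_gt0 // in h.
have : 4 * F * n%:R <= b n * e ^+ r.+2 * n%:R by rewrite ler_wpM2r // ltW.
lra.
Unshelve. all: by end_near. Qed.

Local Notation logF n := (\sum_(k < n) logpart (temp n * (diffbin r.+1 k)%:R)).

(* [temp n * n + logF n] is asymptotically the entropy of the Boltzmann measure. *)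
Lemma cardpart_lower (e : R) : 0 < e -> \forall n \near \oo,
  expR (temp n * n%:R + logF n - e * b n) <= (cardpart r n setT)%:R.
Proof.
move=> e0; have [C C0 QC] := @sum_inv_weight_le R r hr.
pose D : R := 192 * C.
have D0 : 0 < D by apply: mulr_gt0; rewrite ?ltr0n.
(* With the energy window [del = K * kap], the gain [kap * del * c * b n] beats the quadratic cost
   [kap ^+ 2 * D * b n] and leaves a margin proportional to [kap ^+ 2 * c * b n]. *)
pose K : R := 2 * (1 + D / c).
have K0 : 0 < K by rewrite mulr_gt0 // addr_gt0 // divr_gt0.
have D1 : 0 < 2 * c * (2 * K + 1) by rewrite !mulr_gt0 // addr_gt0 // mulr_gt0.
(* The second bound keeps the exponent lost to cooling and to the window below [e / 2 * b n]. *)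
pose kap : R := Num.min 4^-1 (e / (2 * c * (2 * K + 1))).
have k0 : 0 < kap by rewrite lt_min invr_gt0 ltr0n /= divr_gt0.
have k4 : kap <= 4^-1 by rewrite ge_min lexx.
have ke : kap * (2 * c * (2 * K + 1)) <= e.
  by rewrite -ler_pdivlMr // ge_min lexx orbT.
pose del : R := K * kap.
(* Cooling moves the mean energy by a relative amount of order [kap], so the mean must be known to a
   fraction of [kap]. *)
have SN : \forall n \near \oo, `|1 - n%:R^-1 * (\sum_(k < n) (diffbin r.+1 k)%:R *
    bose (temp n * (diffbin r.+1 k)%:R))| < kap / 8.
  have /cvgrPdist_lt H := @cvg_mean_weight R r hr.
  have k8 : 0 < kap / 8 by rewrite divr_gt0.
  exact: H _ k8.
near=> n; have n0 : (0 < n)%N by near: n; exact: nbhs_infty_gt.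
have bn := @scale_gt0 R r n n0; have nR : 0 < n%:R :> R by rewrite ltr0n.
have s0 := @temp_gt0 R r hr n n0.
set S : R := \sum_(k < n) (diffbin r.+1 k)%:R * bose (temp n * (diffbin r.+1 k)%:R).
set Q : R := \sum_(k < n) (1 + temp n * (diffbin r.+1 k)%:R)^-1.
have Qb : Q <= C * b n by exact: QC.
have Sn : `|1 - n%:R^-1 * S| < kap / 8 by rewrite /S; near: n.
have [S1 S2] : (1 - kap / 8) * n%:R <= S /\ S <= (1 + kap / 8) * n%:R.
  move: Sn; rewrite ltr_norml => /andP[h1 h2].
  have SE : S = n%:R^-1 * S * n%:R by rewrite mulrAC mulVf ?mul1r // gt_eqF.
  by split; rewrite SE ler_pM2r //; lra.
have sn := temp_mul n0.
(* Makes both tails at most a quarter; the upper tail, with exponent [kap ^+ 2 / 8 * c * b n], is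
   the tighter one. *)
have bL : 8 * ln 4 / (kap ^+ 2 * c) < b n by near: n; exact: near_scale_gt.
have kc : 0 < kap ^+ 2 * c by rewrite mulr_gt0 // exprn_gt0.
rewrite ltr_pdivrMr // in bL.
have l4 : 0 <= ln 4 :> R by rewrite ln_ge0 // ler1n.
have up : - (kap / 2) * temp n * (n%:R - S / (1 + kap / 2)) <= - ln 4.
  have : kap / 4 * n%:R <= n%:R - S / (1 + kap / 2).
    have k2 : 0 < 1 + kap / 2 by lra.
    have : S / (1 + kap / 2) <= (1 - kap / 4) * n%:R.
      rewrite ler_pdivrMr //; apply: le_trans S2 _.
      rewrite mulrAC ler_pM2r //; nra.
    lra.
  move=> h; have : kap / 2 * temp n * (kap / 4 * n%:R) <=
      kap / 2 * temp n * (n%:R - S / (1 + kap / 2)).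
    by rewrite ler_pM2l // mulr_gt0 // divr_gt0.
  have -> : kap / 2 * temp n * (kap / 4 * n%:R) = kap ^+ 2 / 8 * (temp n * n%:R) by field.
  rewrite sn; move: bL; lra.
have lo : kap * temp n * (1 - del) * n%:R - kap * temp n * S + 192 * kap ^+ 2 * Q <= - ln 4.
  have h1 : kap * temp n * ((1 - kap / 8) * n%:R) <= kap * temp n * S.
    by rewrite ler_pM2l // mulr_gt0.
  have h2 : 192 * kap ^+ 2 * Q <= kap ^+ 2 * (D * b n).
    have -> : 192 * kap ^+ 2 * Q = kap ^+ 2 * (192 * Q) by ring.
    rewrite ler_pM2l ?exprn_gt0 // /D -mulrA; apply: ler_wpM2l => //.
  have e1 : kap * temp n * (1 - del) * n%:R = kap * (1 - del) * (c * b n).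
    by rewrite -sn; ring.
  have e2 : kap * temp n * ((1 - kap / 8) * n%:R) = kap * (1 - kap / 8) * (c * b n).
    by rewrite -sn; ring.
  have e3 : kap * (1 - del) * (c * b n) - kap * (1 - kap / 8) * (c * b n)
      + kap ^+ 2 * (D * b n) =
      - ((2 - 8^-1) * (b n * (kap ^+ 2 * c)) + kap ^+ 2 * (D * b n)).
    by rewrite /del /K; field; rewrite gt_eqF.
  have h3 : 0 <= kap ^+ 2 * (D * b n).
    by rewrite mulr_ge0 ?sqr_ge0 // mulr_ge0 // ltW.
  rewrite e1; rewrite e2 in h1; move: h1 h2 e3 h3 bL l4; lra.
have := @partition_lower_bound R n (cardpart r n setT) (diffbin r.+1) (temp n) kap del S Q
  (diffbin_gt0 r) (fun M P h => @cardpart_ge r n r0 M P n0 h) s0 k0 k4 erefl erefl up lo.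
(* The other half of [e] pays for the polynomial factor. *)
have E2 : 2 * n.+1%:R <= expR (e / 2 * b n).
  by near: n; apply: near_linear_le_exp; rewrite divr_gt0.
move=> low.
have {}low : expR (temp n * (1 + kap) * (1 - del) * n%:R + logF n - kap * temp n * S)
    <= expR (e / 2 * b n) * (cardpart r n setT)%:R.
  by apply: le_trans low _; rewrite ler_wpM2r.
rewrite -ler_pdivrMl ?expR_gt0 // -expRN -expRD in low.
apply: le_trans low; rewrite ler_expR.
have h1 : kap * temp n * S <= kap * temp n * ((1 + kap / 8) * n%:R).
  by rewrite ler_pM2l // mulr_gt0.
have e1 : kap * temp n * ((1 + kap / 8) * n%:R) = kap * (1 + kap / 8) * (c * b n).
  by rewrite -sn; ring.
have e2 : temp n * (1 + kap) * (1 - del) * n%:R = (1 + kap) * (1 - del) * (c * b n).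
  by rewrite -sn; ring.
rewrite e2 sn; rewrite e1 in h1.
have h4 : c * (kap * (2 * K + 1)) <= e / 2 by move: ke; lra.
have h5 : c * (kap * (2 * K + 1)) * b n <= e / 2 * b n by rewrite ler_pM2r.
have h6 : 0 <= (kap * (K + 1) - kap * K * kap - kap * kap / 8) * (c * b n).
  rewrite mulr_ge0 //; last by rewrite mulr_ge0 // ltW.
  have : kap * (K * kap) <= kap * (K * 1) by rewrite ler_pM2l // ler_pM2l //; lra.
  have : kap * kap <= kap * 1 by rewrite ler_pM2l //; lra.
  move: k0; lra.
move: h1 h5 h6; rewrite /del.
have -> : (1 + kap) * (1 - K * kap) * (c * b n) =
  c * b n + kap * (c * b n) - kap * K * (c * b n) - kap * K * kap * (c * b n) by ring.
lra.
Unshelve. all: by end_near. Qed.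

Lemma near_expN_le (e eta : R) : 0 < e -> 0 < eta ->
  \forall n \near \oo, expR (- (e * b n)) <= eta.
Proof.
move=> e0 eta0; near=> n.
have h : (e * eta)^-1 < b n by near: n; exact: near_scale_gt.
have n0 : (0 < n)%N by near: n; exact: nbhs_infty_gt.
have bn := @scale_gt0 R r n n0.
rewrite expRN -[leRHS]invrK lef_pV2 ?posrE ?expR_gt0 ?invr_gt0 //.
apply: le_trans (expR_ge1Dx _); rewrite invfM in h.
have : eta^-1 <= e * b n by rewrite -ler_pdivrMl // ltW.
lra.
Unshelve. all: by end_near. Qed.

Lemma scaled_conj_diagramE t n l : 0 < t -> (0 < n)%N -> partset r n l ->
  scaled_conj_diagram (fun n => n%:R `^ (1 + r%:R)^-1) l t =
  (b n ^+ r)^-1 * (\sum_(k < n | (@first_index R r t n <= k)%N)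
     (diffbin r (k - @first_index R r t n))%:R * (mult r l k)%:R).
Proof.
move=> t0 n0 Xl; have [lA wl] := Xl; have sn := @scale_gt0 R r n n0.
have /andP[j1 j2] := @first_index_itv R r hr t n t0 n0.
rewrite /scaled_conj_diagram wl -/(b n).
have -> : b n / n%:R = (b n ^+ r)^-1.
  by rewrite -(@scale_pow R r n) exprS invfM mulrA divff ?mul1r // gt_eqF.
congr (_ * _); set j := @first_index R r t n in j1 j2 *.
have cj : `|Num.ceil (b n * t)|%N = j.+1.
  rewrite /j /first_index prednK // absz_gt0 gt_eqF // ceil_gt0.
  by rewrite mulr_gt0.
transitivity ((part l j.+1)%:R : R).
  rewrite /conj_diagram mulr_gt0 //= cj; case: ifPn => //.
  (* Beyond the last part the diagram is 0, and so is the default value of [part]. *)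
  rewrite -ltNge => lt; rewrite part_oversize //.
  by rewrite -ltnS -(ltr_nat R); exact: lt_le_trans lt j2.
rewrite (part_mult j lA (partset_size Xl)) /tailsum natr_sum.
by apply: eq_bigr => k _; rewrite natrM.
Qed.

(** The sign [sg] treats deviations above and below the shape at once; a tilt handles one side at a
    time. *)
Lemma deviation (t eps eta sg : R) : 0 < t -> 0 < eps -> 0 < eta ->
  sg = 1 \/ sg = -1 ->
  let G := \int[lebesgue_measure]_(y in `[t, +oo[) limit_shape r t y in
  \forall n \near \oo, (cardpart r n [set l |
      (eps <= sg * (scaled_conj_diagram (fun n => n%:R `^ (1 + r%:R)^-1) l t - G))%R])%:R
    <= eta * (cardpart r n setT)%:R :> R.
Proof.
move=> t0 eps0 eta0 sgE G.
have [C C0 QC] := @sum_inv_weight_le R r hr.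
have sg1 : `|sg| = 1 by case: sgE => ->; rewrite ?normrN normr1.
pose K : R := r%:R / (t * c).
have K0 : 0 < K by rewrite divr_gt0 ?mulr_gt0 // ltr0n.
(* The tilt of mode k is at most [e0 * K] times its energy. The first bound makes this at most 1/2,
   as [logpart_subr_quad] requires; the second keeps the quadratic cost below
   [e0 * b n * eps / 4]. *)
pose e0 : R := Num.min (2^-1 / K) (eps / (4 * (48 * K ^+ 2 * C))).
have D0 : 0 < 4 * (48 * K ^+ 2 * C).
  by do 3 apply: mulr_gt0 => //; exact: exprn_gt0.
have e00 : 0 < e0.
  by rewrite lt_min; apply/andP; split; apply: divr_gt0 => //; rewrite invr_gt0.
have e0K : e0 * K <= 2^-1 by rewrite -ler_pdivlMr // ge_min lexx.
have e0D : e0 * (4 * (48 * K ^+ 2 * C)) <= eps.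
  by rewrite -ler_pdivlMr // ge_min lexx orbT.
have mN : \forall n \near \oo, `|G - (b n ^+ r)^-1 *
    (\sum_(k < n | (@first_index R r t n <= k)%N)
     (diffbin r (k - @first_index R r t n))%:R * bose (temp n * (diffbin r.+1 k)%:R))| < eps / 4.
  have /cvgrPdist_lt H := @cvg_mean_part R r hr t t0.
  by apply: H; rewrite divr_gt0.
near=> n; have n0 : (0 < n)%N by near: n; exact: nbhs_infty_gt.
have bn := @scale_gt0 R r n n0; have s0 := @temp_gt0 R r hr n n0.
have br : b n ^+ r = b n * b n ^+ r.-1 by rewrite -exprS prednK.
set j := @first_index R r t n.
pose x k : R := temp n * (diffbin r.+1 k)%:R.
have x0 k : 0 < x k by exact: temp_weight_gt0.
pose a k : R := if (j <= k)%N then (diffbin r (k - j))%:R else 0.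
(* Parts are of order [b n ^+ r], so this normalization makes the exponent of order [b n]. *)
pose th : R := sg * e0 / b n ^+ r.-1.
pose d k := th * a k.
have dle k : `|d k| <= e0 * K * x k.
  rewrite /d normrM /th normrM normrM sg1 mul1r (ger0_norm (ltW e00)).
  rewrite ger0_norm ?invr_ge0 ?exprn_ge0 ?(ltW bn) // /a; case: ifPn => jk; last first.
    by rewrite normr0 mulr0 ltW // mulr_gt0 // mulr_gt0.
  rewrite ger0_norm //; have := @diffbin_le_weight R r hr n k t t0 n0 jk; rewrite -/j => h.
  have h2 : e0 / b n ^+ r.-1 * (diffbin r (k - j))%:R <=
      e0 / b n ^+ r.-1 * (r%:R / (b n * t) * (diffbin r.+1 k)%:R).
    by rewrite ler_pM2l // divr_gt0 // exprn_gt0.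
  apply: le_trans h2 _; rewrite /x /temp -/c /K br.
  rewrite le_eqVlt; apply/orP; left; apply/eqP; field.
  by rewrite !gt_eqF // ?exprn_gt0.
have dx k : d k < x k.
  apply: le_lt_trans (ler_norm _) _; apply: le_lt_trans (dle k) _.
  by rewrite -[ltRHS]mul1r ltr_pM2r //; move: e0K; lra.
pose A : R := e0 * b n * (sg * G + eps).
set m : R := (b n ^+ r)^-1 * (\sum_(k < n | (j <= k)%N)
     (diffbin r (k - j))%:R * bose (x k)).
have mG : `|G - m| < eps / 4 by rewrite /m /x /j; near: n.
have thE (f : nat -> R) : \sum_(k < n) d k * f k =
    sg * e0 * b n * ((b n ^+ r)^-1 * (\sum_(k < n | (j <= k)%N) (diffbin r (k - j))%:R * f k)).
  have -> : sg * e0 * b n * ((b n ^+ r)^-1 *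
      (\sum_(k < n | (j <= k)%N) (diffbin r (k - j))%:R * f k)) =
      th * (\sum_(k < n | (j <= k)%N) (diffbin r (k - j))%:R * f k).
    rewrite /th mulrA; congr (_ * _); rewrite br; field.
    by rewrite !gt_eqF // exprn_gt0.
  rewrite [in RHS]big_mkcond mulr_sumr; apply: eq_bigr => k _; rewrite /d /a.
  by case: ifP => _; rewrite ?mulr0 ?mul0r // mulrA.
set E := [set l | _].
have H : (cardpart r n E)%:R <= expR (temp n * n%:R - A + \sum_(k < n) logpart (x k - d k)).
  apply: (@cardpart_chernoff r n R (temp n) A d E) => [k _|l Xl El].
    by rewrite subr_gt0; exact: dx.
  rewrite (thE (fun k => (mult r l k)%:R)) -(scaled_conj_diagramE t0 n0 Xl) /A.
  have -> : sg * e0 * b n * scaled_conj_diagram (fun n => n%:R `^ (1 + r%:R)^-1) l t =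
    e0 * b n * (sg * scaled_conj_diagram (fun n => n%:R `^ (1 + r%:R)^-1) l t) by ring.
  rewrite ler_pM2l ?mulr_gt0 //; move: El; rewrite /E /=; lra.
apply: le_trans H _.
have low : expR (temp n * n%:R + logF n - e0 * eps / 4 * b n) <= (cardpart r n setT)%:R.
  by near: n; apply: cardpart_lower; rewrite divr_gt0 // mulr_gt0.
have sm : expR (- (e0 * eps / 4 * b n)) <= eta.
  by near: n; apply: near_expN_le => //; rewrite divr_gt0 // mulr_gt0.
(* In units of [e0 * b n], the deviation gains [eps]; the error of the mean, the quadratic cost and
   the lower bound on the total take [eps / 4] each, and the last quarter produces [eta]. *)
apply: (@le_trans _ _ (expR (- (e0 * eps / 4 * b n)) *
    expR (temp n * n%:R + logF n - e0 * eps / 4 * b n))); last first.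
  by apply: ler_pM => //; exact: expR_ge0.
rewrite -expRD ler_expR.
have Q : \sum_(k < n) logpart (x k - d k) <=
    logF n + sg * e0 * b n * m + 48 * (e0 * K) ^+ 2 * (C * b n).
  apply: (@le_trans _ _ (\sum_(k < n) (logpart (x k) + d k * bose (x k) +
      48 * (e0 * K) ^+ 2 * (1 + x k)^-1))).
    apply: ler_sum => k _; have := logpart_subr_quad (x0 k) e0K (dle k); lra.
  rewrite !big_split /= (thE (fun k => bose (x k))) -mulr_sumr lerD2l.
  rewrite ler_wpM2l //; first by rewrite mulr_ge0 // exprn_ge0 // mulr_ge0 // ltW.
  exact: QC.
have mb : sg * m <= sg * G + eps / 4.
  have : `|sg * (G - m)| < eps / 4 by rewrite normrM sg1 mul1r.
  by rewrite ltr_norml => /andP[]; lra.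
have mb2 : e0 * b n * (sg * m) <= e0 * b n * (sg * G + eps / 4).
  by rewrite ler_pM2l ?mulr_gt0.
have q2 : 48 * (e0 * K) ^+ 2 * (C * b n) <= e0 * b n * (eps / 4).
  have -> : 48 * (e0 * K) ^+ 2 * (C * b n) =
    e0 * b n * (e0 * (4 * (48 * K ^+ 2 * C)) / 4) by field.
  by rewrite ler_pM2l ?mulr_gt0 // ler_pM2r // invr_gt0.
rewrite /A; move: Q mb2 q2.
have -> : sg * e0 * b n * m = e0 * b n * (sg * m) by ring.
lra.
Unshelve. all: by end_near. Qed.

End concentration.

(** * From deviation bounds to the limit shape *)

Unset Implicit Arguments.
Set Strict Implicit.

Theorem theorem5p1 (R : realType) (r : nat) (hr : (2 <= r)%N) :
  let c : R := dconst r%:R (r`!%:R^-1) in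
  conjugate_limit_shape (nonneg_differences r)
    (fun n => n%:R `^ (1 + r%:R)^-1)
    (fun t => \int[lebesgue_measure]_(y in `[t, +oo[)
       ((y - t) ^+ r.-1 / r.-1`!%:R
        * (expR (- (c * y ^+ r / r`!%:R))
           / (1 - expR (- (c * y ^+ r / r`!%:R)))))).
Proof.
move=> c k t eps tP eps0.
pose G (t : R) : R := \int[lebesgue_measure]_(y in `[t, +oo[) limit_shape r t y.
set lam := scaled_conj_diagram _.
apply/cvgrPdist_le => e e0.
pose I : finType := ('I_k * bool)%type.
(* Union bound over the k points and two signs; [k.+1] keeps the denominator positive when k = 0. *)
pose eta : R := e / (2 * k.+1%:R).
have k0 : 0 < k.+1%:R :> R by rewrite ltr0n.
have eta0 : 0 < eta by rewrite divr_gt0 // mulr_gt0.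
pose B (i : 'I_k * bool) : set intpart :=
  [set l | eps <= (if i.2 then 1 else -1) * (lam l (t i.1) - G (t i.1))].
have dev : \forall n \near \oo, forall i : 'I_k * bool,
    (cardpart r n (B i))%:R <= eta * (cardpart r n setT)%:R :> R.
  apply: filter_forall => -[j s].
  apply: (@deviation R r hr (t j) eps eta (if s then 1 else -1)) => //.
    by have [] := tP j.
  by case: s; [left|right].
near=> n; have n0 : (0 < n)%N by near: n; exact: nbhs_infty_gt.
have devn : forall i : 'I_k * bool, (cardpart r n (B i))%:R <= eta * (cardpart r n setT)%:R :> R.
  by near: n.
set E := [set l | _].
rewrite /unif_prob -/(partset r n) cardpart_setT -/(cardpart r n E).
have N0 : 0 < (cardpart r n setT)%:R :> R by rewrite ltr0n cardpart_gt0 // ltnW.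
have NE : (cardpart r n E <= cardpart r n setT)%N by exact: cardpart_mono.
have cov : (cardpart r n setT <=
    cardpart r n E + \sum_(i <- enum I) cardpart r n (B i))%N.
  apply: cardpart_cover => l Xl; have [El|nE] := pselect (E l); [by left | right].
  move/existsNP : nE => [j /negP]; rewrite -leNgt => h.
  have [p|q] := leP 0 (lam l (t j) - G (t j)).
    exists (j, true); first by rewrite mem_enum.
    by rewrite /B /= mul1r; rewrite ger0_norm in h.
  exists (j, false); first by rewrite mem_enum.
  by rewrite /B /= mulN1r; rewrite ltr0_norm in h.
have h : (cardpart r n setT)%:R <= (cardpart r n E)%:R + e * (cardpart r n setT)%:R :> R.
  apply: le_trans (_ : (cardpart r n E)%:R + \sum_(i <- enum I) (cardpart r n (B i))%:R <= _).
    by rewrite -natr_sum -natrD ler_nat.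
  rewrite lerD2l.
  apply: (@le_trans _ _ (\sum_(i <- enum I) eta * (cardpart r n setT)%:R)).
    by apply: ler_sum => i _; exact: devn.
  rewrite big_enum sumr_const card_prod card_ord card_bool -[X in X <= _]mulr_natl mulrA.
  rewrite ler_pM2r //.
  rewrite /eta mulrA ler_pdivrMr ?mulr_gt0 // [leLHS]mulrC ler_pM2l // natrM mulrC.
  by rewrite ler_pM2l // ler_nat.
rewrite ger0_norm; last first.
  by rewrite subr_ge0 ler_pdivrMr // mul1r ler_nat.
have : (1 - e) * (cardpart r n setT)%:R <= (cardpart r n E)%:R by move: h; lra.
by rewrite -ler_pdivlMr //; lra.
Unshelve. all: by end_near.
Qed.
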